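(* Let $H$ be a Hilbert space and let $\mathcal T=(T(t))_{t\ge0}$ be a $C_0$-semigroup on $H$. The following are equivalent. (i) $\mathcal T$ is similar to a quasi-contraction semigroup, i.e. there exist an invertible $R\in\mathcal L(H)$ and $\lambda\in\mathbb R$ with $\|RT(t)R^{-1}\|\le e^{\lambda t}$ for all $t\ge0$. (ii) For each $\nu>0$, there exist a Hilbert space $K$, $B\in\mathcal L(H,K)$, $A\in\mathcal L(K,H)$ and a contractive nilpotent $C_0$-semigroup $\mathcal N=(N(t))_{t\ge0}$ on $K$ (i.e. $\|N(t)\|\le1$ for all $t$ and $N(t_0)=0$ for some $t_0>0$) such that $T(t)=AN(t)B$ for all $t\in[0,\nu]$. (iii) For each $\nu>0$, there exist a Hilbert space $K$, $B\in\mathcal L(H,K)$, $A\in\mathcal L(K,H)$ and a unitary $C_0$-group $\mathcal U=(U(t))_{t\in\mathbb R}$ on $K$ such that $T(t)=AU(t)B$ for all $t\in[0,\nu]$. (iv) There exist $\nu>0$, a Hilbert space $K$, $B\in\mathcal L(H,K)$, $A\in\mathcal L(K,H)$ and a $C_0$-semigroup $\mathcal S=(S(t))_{t\ge0}$ on $K$ which is similar to a quasi-contraction semigroup, such that $T(t)=AS(t)B$ for all $t\in[0,\nu]$.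
   Context: A $C_0$-semigroup $\mathcal S$ on a Hilbert space $K$ is a quasi-contraction semigroup if $\|S(t)\|\le e^{\lambda t}$ for all $t\ge0$ for some $\lambda\in\mathbb R$; it is similar to a quasi-contraction semigroup if there is an invertible $R\in\mathcal L(K)$ such that $(RS(t)R^{-1})_{t\ge0}$ is a quasi-contraction semigroup. *)

(* Defs.v *)
From HB Require Import structures.
From mathcomp Require Import all_boot all_order all_algebra.
From mathcomp Require Import reals.
From mathcomp Require Import sequences.
From mathcomp.analysis Require Import exp.
From mathcomp Require Import complex.
Set Implicit Arguments. Unset Strict Implicit. Unset Printing Implicit Defensive.
Import Order.TTheory GRing.Theory Num.Theory.
Local Open Scope ring_scope.

Section HilbertDef.
Variable R : realType.
Local Notation C := R[i].

Definition inner_product_axioms (V : lmodType C) (ip : V -> V -> C) : Prop :=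
  [/\ (forall (a : C) (x y z : V), ip (a *: x + y) z = a * ip x z + ip y z),
      (forall x y : V, ip y x = conjc (ip x y)),
      (forall x : V, 0 <= complex.Re (ip x x)) &
      (forall x : V, ip x x = 0 -> x = 0)].

Definition ip_norm (V : lmodType C) (ip : V -> V -> C) (x : V) : R :=
  Num.sqrt (complex.Re (ip x x)).

Definition ip_complete (V : lmodType C) (ip : V -> V -> C) : Prop :=
  forall u : nat -> V,
    (forall eps : R, 0 < eps -> exists N : nat, forall m n : nat,
        (N <= m)%N -> (N <= n)%N -> ip_norm ip (u m - u n) < eps) ->
    exists l : V, forall eps : R, 0 < eps -> exists N : nat, forall n : nat,
        (N <= n)%N -> ip_norm ip (u n - l) < eps.

End HilbertDef.

Record hilbertType (R : realType) := HilbertType {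
  hsort :> lmodType R[i];
  hinner : hsort -> hsort -> R[i];
  hinner_ax : inner_product_axioms hinner;
  hcomplete : ip_complete hinner
}.

Definition hnorm (R : realType) (H : hilbertType R) (x : H) : R :=
  ip_norm (@hinner R H) x.

Section Operators.
Variable R : realType.
Local Notation C := R[i].

Definition bounded_op (H K : hilbertType R) (f : H -> K) : Prop :=
  (forall (a : C) (x y : H), f (a *: x + y) = a *: f x + f y) /\
  exists M : R, forall x : H, hnorm (f x) <= M * hnorm x.

Definition invertible_op (H : hilbertType R) (Rop : H -> H) : Prop :=
  bounded_op Rop /\
  exists Rinv : H -> H, [/\ bounded_op Rinv,
     (forall x, Rop (Rinv x) = x) & (forall x, Rinv (Rop x) = x)].

(** C0-semigroup (T(t))_{t>=0} on H (values for t < 0 are irrelevant). *)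
Definition C0_semigroup (H : hilbertType R) (T : R -> H -> H) : Prop :=
  [/\ (forall t, 0 <= t -> bounded_op (T t)),
      (forall x, T 0 x = x),
      (forall t s x, 0 <= t -> 0 <= s -> T (t + s) x = T t (T s x)) &
      (forall x (eps : R), 0 < eps -> exists2 delta : R, 0 < delta &
          forall t, 0 <= t -> t < delta -> hnorm (T t x - x) < eps)].

Definition quasi_contraction (H : hilbertType R) (S : R -> H -> H) : Prop :=
  exists lambda : R, forall t, 0 <= t ->
    forall x, hnorm (S t x) <= expR (lambda * t) * hnorm x.

Definition similar_to_quasi_contraction (H : hilbertType R) (S : R -> H -> H)
  : Prop :=
  exists Rop Rinv : H -> H,
    [/\ invertible_op Rop, (forall x, Rop (Rinv x) = x),
        (forall x, Rinv (Rop x) = x) &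
        quasi_contraction (fun t x => Rop (S t (Rinv x)))].

Definition contractive_nilpotent_C0_semigroup (K : hilbertType R)
  (N : R -> K -> K) : Prop :=
  [/\ C0_semigroup N,
      (forall t, 0 <= t -> forall x, hnorm (N t x) <= hnorm x) &
      exists2 t0 : R, 0 < t0 & forall x, N t0 x = 0].

Definition unitary_op (K : hilbertType R) (U : K -> K) : Prop :=
  [/\ (forall (a : C) (x y : K), U (a *: x + y) = a *: U x + U y),
      (forall x y, hinner (U x) (U y) = hinner x y) &
      (forall y, exists x, U x = y)].

Definition unitary_C0_group (K : hilbertType R) (U : R -> K -> K) : Prop :=
  [/\ (forall t, unitary_op (U t)),
      (forall x, U 0 x = x),
      (forall t s x, U (t + s) x = U t (U s x)) &
      (forall x (eps : R), 0 < eps -> exists2 delta : R, 0 < delta &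
          forall t, `|t| < delta -> hnorm (U t x - x) < eps)].

End Operators.

(* Main.v *)
Require Import Defs.
From HB Require Import structures.
From mathcomp Require Import all_boot all_order all_algebra.
From mathcomp Require Import reals.
From mathcomp Require Import sequences.
From mathcomp.analysis Require Import exp.
From mathcomp Require Import all_classical all_reals all_analysis.
From mathcomp Require Import complex ring lra.
Set Implicit Arguments. Unset Strict Implicit. Unset Printing Implicit Defensive.
Import Order.TTheory GRing.Theory Num.Theory.
Import numFieldNormedType.Exports.
Local Open Scope classical_set_scope.
Local Open Scope ring_scope.

(** (i) => (ii): after rescaling, T(t) is similar to exp(lambda t) S(t) with S contractive.  On the
    closed span of the functions 1_[0,c] x (0 <= c <= b) in L^2(0, oo; H), the left shift combined
    with S(t) is a contractive semigroup vanishing at time b; pairing the orbit of 1_[0,b] x with a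
    Lipschitz weight vanishing at 0 gives exp(lambda t) S(t) x for t <= nu.  (ii) => (iii) is the
    Sz.-Nagy dilation.  Both Hilbert spaces are completions of spaces of finite formal sums for a
    positive kernel, and positivity is checked by induction on the ordered list of the points.

    (iv) => (i): after rescaling, T(t) = A S(t) B on [0, nu] with S contractive.  Let p_a(x) be the
    distance from B x to the vectors of span{S(s) B y : s <= a} killed by A.  These Hilbertian norms
    are equivalent to the given one, decrease with a, and p_(a+t)(T(t) x) <= p_a(x).  Hence
    |x|^2 = average of p_a(x)^2 over a in [0, nu] satisfies |T(t) x|^2 <= (1 + mu t) |x|^2 for
    t <= nu, and the positive square root of its Gram operator is the required similarity.  As
    a |-> p_a(x)^2 is monotone, the average is the limit of the dyadic Riemann sums. *)

(** * Semi-inner products *)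

(** The step functions enter only through the kernel min(c, d) <x, y>, the L^2 inner product of
    1_[0,c] x and 1_[0,d] y, so no vector-valued integral is formed. The weight has to vanish at 0
    because 1_[0,c] x tends to 0 with c; at c = b - t it equals exp(lambda (b - c)) to undo the
    rescaling, and b = nu + 1 leaves a unit interval on which it can climb. In (iv) => (i) a single
    p_a does not do, since T(t) moves the index from a to a + t. Averaging absorbs the move: for
    T(t) x the indices a >= t are controlled by p_(a-t)(x), and those below t have total weight t /
    nu, hence cost at most a constant times (t / nu) |x|^2. Indices stay below nu since A S(s + t) B
    = T(t) A S(s) B is available only for s + t <= nu. The lower bound |x| <= |A| p_a(x) comes from
    A B = 1: A (B x - z) = x for every z killed by A. Times beyond nu are reached by cutting t into
    equal short pieces; this works because 1 + mu t <= exp(mu t) has no constant in front. *)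

Section SemiInner.
Variable R : realType.
Local Notation C := R[i].
Local Notation Re := complex.Re.
Local Notation Im := complex.Im.

Lemma cReD (a b : C) : Re (a + b) = Re a + Re b. Proof. by case: a b => ? ? []. Qed.
Lemma cImD (a b : C) : Im (a + b) = Im a + Im b. Proof. by case: a b => ? ? []. Qed.
Lemma cReM (a b : C) : Re (a * b) = Re a * Re b - Im a * Im b.
Proof. by case: a b => ? ? []. Qed.
Lemma cImM (a b : C) : Im (a * b) = Re a * Im b + Im a * Re b.
Proof. by case: a b => ? ? []. Qed.
Lemma cReN (a : C) : Re (- a) = - Re a. Proof. by case: a. Qed.
Lemma cImN (a : C) : Im (- a) = - Im a. Proof. by case: a. Qed.
Lemma cReJ (a : C) : Re (conjc a) = Re a. Proof. by case: a. Qed.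
Lemma cImJ (a : C) : Im (conjc a) = - Im a. Proof. by case: a. Qed.
Lemma complex_ext (a b : C) : Re a = Re b -> Im a = Im b -> a = b.
Proof. by case: a b => ? ? [? ?] /= -> ->. Qed.
Lemma cReR (r : R) : Re (r%:C)%C = r. Proof. by []. Qed.
Lemma cImR (r : R) : Im (r%:C)%C = 0. Proof. by []. Qed.
Lemma cRe1 : Re (1 : C) = 1. Proof. by []. Qed.
Lemma cIm1 : Im (1 : C) = 0. Proof. by []. Qed.
Lemma cRe0 : Re (0 : C) = 0. Proof. by []. Qed.
Lemma cIm0 : Im (0 : C) = 0. Proof. by []. Qed.
Definition reimE := (cReD, cImD, cReM, cImM, cReN, cImN, cReJ, cImJ, cReR, cImR, cRe1, cIm1, cRe0, cIm0).

(** For c > 0 evaluate at the minimum t = - b / c; for c = 0 an affine function of t is nonnegative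
    everywhere only if b = 0. The degenerate case matters because the forms below may have null
    vectors. *)
Lemma discriminant_le (a b c : R) : 0 <= a -> 0 <= c ->
  (forall t, 0 <= a + 2 * t * b + t ^+ 2 * c) -> b ^+ 2 <= a * c.
Proof.
move=> a0 c0 key; have [c00|cn0] := eqVneq c 0.
  have [->|bn0] := eqVneq b 0; first by rewrite expr0n /= c00 mulr0.
  have := key (- (a + 1) / (2 * b)); rewrite c00 mulr0 addr0.
  have -> : a + 2 * (- (a + 1) / (2 * b)) * b = -1 by field.
  by rewrite ler0N1.
have cp : 0 < c by rewrite lt_def cn0.
have := key (- b / c).
have -> : a + 2 * (- b / c) * b + (- b / c) ^+ 2 * c = (a * c - b ^+ 2) / c by field.
by rewrite pmulr_lge0 ?invr_gt0 // subr_ge0.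
Qed.

(** No laws are imposed on [add] and [scl]: the carrier will be lists of formal terms under
    concatenation, which obey the vector space laws only up to null vectors. Identities between
    vectors are therefore checked after pairing, and subtraction is spelled with [scl (-1)]. *)
Definition semi_inner (V : Type) (add : V -> V -> V) (scl : C -> V -> V)
    (s : V -> V -> C) : Prop :=
  [/\ (forall x y z, s (add x y) z = s x z + s y z),
      (forall a x z, s (scl a x) z = a * s x z),
      (forall x y, s y x = conjc (s x y)) &
      (forall x, 0 <= Re (s x x))].

Lemma inner_product_semi (V : lmodType C) (ip : V -> V -> C) :
  inner_product_axioms ip -> semi_inner +%R *:%R ip.
Proof.
move=> [hl hc h0 _].
have h00 z : ip 0 z = 0.
  have := hl 1 0 0 z; rewrite scaler0 addr0 mul1r => h.
  by apply: (addrI (ip 0 z)); rewrite -h addr0.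
split => //.
  by move=> x y z; rewrite -{1}(scale1r x) hl mul1r.
by move=> a x z; rewrite -{1}(addr0 (a *: x)) hl h00 addr0.
Qed.

Definition seminorm (V : Type) (s : V -> V -> C) (x : V) : R := Num.sqrt (Re (s x x)).

Section Theory.
Variables (V : Type) (add : V -> V -> V) (scl : C -> V -> V) (s : V -> V -> C).
Hypothesis hs : semi_inner add scl s.
Local Notation q := (seminorm s).
Local Notation sub x y := (add x (scl (-1) y)).

Lemma sinDl x y z : s (add x y) z = s x z + s y z. Proof. by case: hs. Qed.
Lemma sinZl a x z : s (scl a x) z = a * s x z. Proof. by case: hs. Qed.
Lemma sinC x y : s y x = conjc (s x y). Proof. by case: hs. Qed.
Lemma sin_ge0 x : 0 <= Re (s x x). Proof. by case: hs. Qed.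
Lemma sinDr x y z : s z (add x y) = s z x + s z y.
Proof. by rewrite sinC sinDl rmorphD /= -!sinC. Qed.
Lemma sinZr a x z : s z (scl a x) = conjc a * s z x.
Proof. by rewrite sinC sinZl rmorphM /= -!sinC. Qed.

Lemma cReC x y : Re (s y x) = Re (s x y). Proof. by rewrite sinC cReJ. Qed.
Lemma cIm_diag x : Im (s x x) = 0.
Proof. have : Im (s x x) = - Im (s x x) by rewrite {1}sinC cImJ.
lra. Qed.

Lemma sn_ge0 x : 0 <= q x. Proof. exact: sqrtr_ge0. Qed.
Lemma sn_sqr x : q x ^+ 2 = Re (s x x). Proof. by rewrite sqr_sqrtr // sin_ge0. Qed.

Lemma Re_sin_le x y : `|Re (s x y)| <= q x * q y.
Proof.
rewrite -(@ler_pXn2r _ 2) ?nnegrE ?normr_ge0 ?mulr_ge0 ?sn_ge0 // exprMn !sn_sqr real_normK ?num_real //.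
apply: discriminant_le; [exact: sin_ge0|exact: sin_ge0|move=> t].
have := sin_ge0 (add x (scl (t%:C)%C y)).
rewrite !(sinDl, sinDr, sinZl, sinZr) !reimE (cReC x y) (cIm_diag y).
by congr (_ <= _); ring.
Qed.

Lemma sn_scl a x : q (scl a x) = complex.Re `|a| * q x.
Proof.
rewrite /seminorm sinZl sinZr mulrA !reimE (cIm_diag x) mulr0 subr0.
rewrite sqrtrM; last by rewrite mulrN opprK -!expr2 addr_ge0 ?sqr_ge0.
by case: a => u v; rewrite /= mulrN opprK -!expr2.
Qed.

Lemma sn_opp x : q (scl (-1) x) = q x.
Proof. by rewrite sn_scl normrN1 /= mul1r. Qed.

Lemma Im_sinE x y : Im (s x y) = Re (s (scl (- 'i%C) x) y).
Proof. by rewrite sinZl cReM cReN cImN /= oppr0 mul0r sub0r mulN1r opprK. Qed.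

Lemma Im_sin_le x y : `|Im (s x y)| <= q x * q y.
Proof.
rewrite Im_sinE; apply: le_trans (Re_sin_le _ _) _; rewrite sn_scl normrN.
by rewrite /= expr0n /= expr1n add0r sqrtr1 mul1r.
Qed.

Lemma sn_add x y : q (add x y) <= q x + q y.
Proof.
rewrite -(@ler_pXn2r _ 2) ?nnegrE ?addr_ge0 ?sn_ge0 // sqrrD !sn_sqr.
rewrite !(sinDl, sinDr) !cReD (cReC x y).
by have := le_trans (ler_norm _) (Re_sin_le x y); lra.
Qed.

Lemma sn_dist x y : `|q x - q y| <= q (sub x y).
Proof.
rewrite ler_distl; apply/andP; split.
  have -> : q y = q (add (sub y x) x).
    rewrite /seminorm !(sinDl, sinDr, sinZl, sinZr) !reimE; congr (Num.sqrt _); lra.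
  have -> : q (sub x y) = q (sub y x).
    rewrite /seminorm !(sinDl, sinDr, sinZl, sinZr) !reimE; congr (Num.sqrt _); lra.
  by rewrite lerBlDl sn_add.
have -> : q x = q (add (sub x y) y).
  rewrite /seminorm !(sinDl, sinDr, sinZl, sinZr) !reimE; congr (Num.sqrt _); lra.
by rewrite addrC sn_add.
Qed.

End Theory.
End SemiInner.

(** * Limits of real sequences *)

Section RealSeq.
Variable R : realType.
Implicit Types f g e : nat -> R.

Lemma seq_cvgP f (l : R) : f @ \oo --> l <->
  forall eps, 0 < eps -> exists N : nat, forall n, (N <= n)%N -> `|f n - l| < eps.
Proof.
split=> [/cvgrPdist_lt h eps /h [N _ hN]|h].
  by exists N => n Nn; rewrite distrC; exact: hN.
apply/cvgrPdist_lt => eps /h [N hN]; exists N => // n /= /hN.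
by rewrite distrC.
Qed.

Lemma seq_cvg0_le f e : (forall n, `|f n| <= e n) -> e @ \oo --> 0 -> f @ \oo --> 0.
Proof.
move=> fe /seq_cvgP he; apply/seq_cvgP => eps /he [N hN].
exists N => n /hN; rewrite !subr0; apply: le_lt_trans.
by apply: le_trans (fe n) _; exact: ler_norm.
Qed.

Lemma seq_cvg_dist f l e : (forall n, `|f n - l| <= e n) -> e @ \oo --> 0 -> f @ \oo --> l.
Proof.
move=> fe /seq_cvgP he; apply/seq_cvgP => eps /he [N hN].
exists N => n /hN; rewrite subr0; apply: le_lt_trans.
by apply: le_trans (fe n) _; exact: ler_norm.
Qed.

Lemma seq_cauchy_cvg f :
  (forall eps, 0 < eps -> exists N : nat, forall m n, (N <= m)%N -> (N <= n)%N ->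
     `|f m - f n| < eps) -> exists l : R, f @ \oo --> l.
Proof.
move=> h; suff : cvg (f @ \oo) by move=> /cvg_ex [l ?]; exists l.
apply/cauchy_cvgP/cauchy_exP => eps /h [N hN].
by exists (f N); exists N => // n /= Nn; apply: hN.
Qed.

Lemma seq_cvg_ext f g (a : R) : (forall n, f n = g n) -> f @ \oo --> a -> g @ \oo --> a.
Proof. by move=> /funext ->. Qed.

Lemma seq_cvg_uniq f (a b : R) : f @ \oo --> a -> f @ \oo --> b -> a = b.
Proof. by move=> fa fb; exact: (cvg_unique _ fa fb). Qed.

Lemma seq_cvg_le f g (a b : R) : f @ \oo --> a -> g @ \oo --> b ->
  (forall n, f n <= g n) -> a <= b.
Proof.
move=> fa gb fg; rewrite -(cvg_lim _ fa) // -(cvg_lim _ gb) //.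
apply: ler_lim; [by apply/cvg_ex; exists a|by apply/cvg_ex; exists b|exact: nearW].
Qed.

Lemma seq_cvg_lec f (a c : R) : f @ \oo --> a -> (forall n, f n <= c) -> a <= c.
Proof. by move=> fa; apply: seq_cvg_le fa _; exact: cvg_cst. Qed.

Lemma seq_cvgM0 (M : R) e : e @ \oo --> 0 -> (fun n => M * e n) @ \oo --> 0.
Proof. by move=> he; rewrite -(mulr0 M); apply: cvgM => //; exact: cvg_cst. Qed.

Lemma seq_cvgD0 f e : f @ \oo --> 0 -> e @ \oo --> 0 -> (fun n => f n + e n) @ \oo --> 0.
Proof. by move=> hf he; rewrite -(addr0 0); exact: cvgD. Qed.

Lemma harmonic_cvg0 : (fun n => n.+1%:R^-1 : R) @ \oo --> 0.
Proof. exact: cvg_harmonic. Qed.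

End RealSeq.

(** * Hilbert spaces and bounded operators *)

Section HilbertBasics.
Variable R : realType.
Local Notation C := R[i].
Local Notation Re := complex.Re.

Definition rip (H : hilbertType R) (x y : H) : R := Re (hinner x y).

Section One.
Variable H : hilbertType R.
Implicit Types (x y z : H) (a : C) (u v : nat -> H).

Lemma hinner_semi : semi_inner +%R *:%R (@hinner R H).
Proof. exact: inner_product_semi (hinner_ax H). Qed.

Lemma ripDl x y z : rip (x + y) z = rip x z + rip y z.
Proof. by rewrite /rip (sinDl hinner_semi) cReD. Qed.
Lemma ripC x y : rip x y = rip y x.
Proof. exact: (cReC hinner_semi). Qed.
Lemma ripDr x y z : rip z (x + y) = rip z x + rip z y.
Proof. by rewrite ripC ripDl !(ripC z). Qed.
Lemma ripZ a x y : rip (a *: x) y = rip x (conjc a *: y).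
Proof. by rewrite /rip (sinZl hinner_semi) (sinZr hinner_semi) conjcK. Qed.
Lemma ripRl (r : R) x y : rip ((r%:C)%C *: x) y = r * rip x y.
Proof. by rewrite /rip (sinZl hinner_semi) cReM cImR cReR mul0r subr0. Qed.
Lemma ripRr (r : R) x y : rip x ((r%:C)%C *: y) = r * rip x y.
Proof. by rewrite ripC ripRl ripC. Qed.
Lemma ripNl x y : rip (- x) y = - rip x y.
Proof. by rewrite -scaleN1r /rip (sinZl hinner_semi) mulN1r cReN. Qed.
Lemma ripNr x y : rip x (- y) = - rip x y.
Proof. by rewrite ripC ripNl ripC. Qed.
Lemma ripBl x y z : rip (x - y) z = rip x z - rip y z.
Proof. by rewrite ripDl ripNl. Qed.
Lemma ripBr x y z : rip z (x - y) = rip z x - rip z y.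
Proof. by rewrite ripDr ripNr. Qed.
Lemma rip0l x : rip 0 x = 0.
Proof. by rewrite -(subrr 0) ripBl subrr. Qed.
Lemma rip0r x : rip x 0 = 0. Proof. by rewrite ripC rip0l. Qed.
Definition ripE := (ripDl, ripDr, ripNl, ripNr, ripRl, ripRr, rip0l, rip0r).

(** The imaginary part is the real part after multiplying by ['i], so the proof can work with the
    real form [rip] and return to [hinner] only where unitarity is to be shown. *)
Lemma hinnerE x y : hinner x y = (rip x y +i* rip x ('i *: y))%C.
Proof.
apply: complex_ext => //=; rewrite /rip (sinZr hinner_semi) cReM /=.
by rewrite mul0r sub0r mulN1r opprK.
Qed.

Lemma hn_ge0 x : 0 <= hnorm x. Proof. exact: sn_ge0. Qed.
Lemma hn_sqr x : hnorm x ^+ 2 = rip x x. Proof. exact: (sn_sqr hinner_semi). Qed.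
Lemma rip_ge0 x : 0 <= rip x x. Proof. by rewrite -hn_sqr sqr_ge0. Qed.
Lemma rip_eq0 x : rip x x = 0 -> x = 0.
Proof.
move=> h; have [_ _ _ h0] := hinner_ax H; apply: h0.
by apply: complex_ext => //; exact: (cIm_diag hinner_semi).
Qed.
Lemma hn_eq0 x : hnorm x = 0 -> x = 0.
Proof. by move=> h; apply: rip_eq0; rewrite -hn_sqr h expr0n. Qed.
Lemma rip_le x y : rip x y <= hnorm x * hnorm y.
Proof. by apply: le_trans (ler_norm _) _; exact: (Re_sin_le hinner_semi). Qed.
Lemma norm_rip_le x y : `|rip x y| <= hnorm x * hnorm y.
Proof. exact: (Re_sin_le hinner_semi). Qed.
Lemma hnZ a x : hnorm (a *: x) = Re `|a| * hnorm x.
Proof. exact: (sn_scl hinner_semi). Qed.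
Lemma hnR (r : R) x : hnorm ((r%:C)%C *: x) = `|r| * hnorm x.
Proof. by rewrite hnZ /= expr0n /= addr0 sqrtr_sqr. Qed.
Lemma hnN x : hnorm (- x) = hnorm x.
Proof. by rewrite -scaleN1r; exact: (sn_opp hinner_semi). Qed.
Lemma hnD x y : hnorm (x + y) <= hnorm x + hnorm y.
Proof. exact: (sn_add hinner_semi). Qed.
Lemma hn0 : hnorm (0 : H) = 0.
Proof. by apply/eqP; rewrite -sqrf_eq0 hn_sqr rip0l. Qed.
Lemma hnB x y : hnorm (x - y) = hnorm (y - x).
Proof. by rewrite -hnN opprB. Qed.
Lemma hn_triangle z x y : hnorm (x - y) <= hnorm (x - z) + hnorm (z - y).
Proof. by rewrite -{1}(subrK z x) -addrA; exact: hnD. Qed.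
Lemma hn_dist x y : `|hnorm x - hnorm y| <= hnorm (x - y).
Proof. by have := sn_dist hinner_semi x y; rewrite scaleN1r. Qed.
Lemma hn_le_sqr x (r : R) : 0 <= r -> rip x x <= r ^+ 2 -> hnorm x <= r.
Proof. by move=> r0; rewrite -hn_sqr ler_pXn2r ?nnegrE ?hn_ge0. Qed.

Definition hcvg u (l : H) := (fun n => hnorm (u n - l)) @ \oo --> (0 : R).

Definition hcauchy u := forall eps : R, 0 < eps -> exists N : nat, forall m n : nat,
  (N <= m)%N -> (N <= n)%N -> hnorm (u m - u n) < eps.

Lemma hcvgP u l : hcvg u l <-> forall eps : R, 0 < eps -> exists N : nat, forall n : nat,
  (N <= n)%N -> hnorm (u n - l) < eps.
Proof.
split=> [/seq_cvgP h eps /h [N hN]|h].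
  by exists N => n /hN; rewrite subr0 ger0_norm // hn_ge0.
apply/seq_cvgP => eps /h [N hN].
by exists N => n /hN; rewrite subr0 ger0_norm // hn_ge0.
Qed.

Lemma hcauchy_cvg u : hcauchy u -> exists l, hcvg u l.
Proof. by move=> /(@hcomplete _ H u) [l hl]; exists l; apply/hcvgP. Qed.

Lemma hcvg_cauchy u l : hcvg u l -> hcauchy u.
Proof.
move=> /hcvgP h eps e0; have [N hN] := h _ (divr_gt0 e0 (ltr0n _ 2)).
exists N => m n /hN h1 /hN h2; rewrite (splitr eps).
by apply: le_lt_trans (hn_triangle l _ _) _; rewrite [X in _ + X]hnB ltrD.
Qed.

Lemma hcvg_le u l (e : nat -> R) : (forall n, hnorm (u n - l) <= e n) ->
  e @ \oo --> 0 -> hcvg u l.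
Proof. by move=> h; apply: seq_cvg0_le => n; rewrite ger0_norm ?hn_ge0. Qed.

Lemma hcvg_cst l : hcvg (fun=> l) l.
Proof. by rewrite /hcvg subrr hn0; exact: cvg_cst. Qed.

Lemma hcvgD u v l m : hcvg u l -> hcvg v m -> hcvg (fun n => u n + v n) (l + m).
Proof.
move=> hu hv; apply: hcvg_le (seq_cvgD0 hu hv) => n.
by rewrite opprD addrACA hnD.
Qed.

Lemma hcvgZ a u l : hcvg u l -> hcvg (fun n => a *: u n) (a *: l).
Proof.
move=> hu; apply: hcvg_le (seq_cvgM0 (Re `|a|) hu) => n.
by rewrite -scalerBr hnZ.
Qed.

Lemma hcvgN u l : hcvg u l -> hcvg (fun n => - u n) (- l).
Proof. by move=> hu; apply: hcvg_le hu => n; rewrite -opprD hnN. Qed.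

Lemma hcvgB u v l m : hcvg u l -> hcvg v m -> hcvg (fun n => u n - v n) (l - m).
Proof. by move=> hu /hcvgN; exact: hcvgD. Qed.

Lemma hcvg_norm u l : hcvg u l -> (fun n => hnorm (u n)) @ \oo --> hnorm l.
Proof. by apply: seq_cvg_dist => n; exact: hn_dist. Qed.

Lemma hcvg_ext u v l : (forall n, u n = v n) -> hcvg u l -> hcvg v l.
Proof. by move=> /funext ->. Qed.

Lemma hcvg_uniq u l m : hcvg u l -> hcvg u m -> l = m.
Proof.
move=> hl hm; apply/eqP; rewrite -subr_eq0; apply/eqP; apply: hn_eq0.
apply: le_anti; rewrite hn_ge0 andbT.
apply: (seq_cvg_le (cvg_cst _) (seq_cvgD0 hl hm)) => n.
by rewrite (hnB (u n) l) hn_triangle.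
Qed.

(** Reduces the continuity of the inner product, and its invariance under linear isometries, to
    statements about norms. *)
Lemma rip_polar x y : rip x y = (hnorm (x + y) ^+ 2 - hnorm (x - y) ^+ 2) / 4.
Proof. by rewrite !hn_sqr !ripE (ripC y x); field. Qed.

Lemma hcvg_rip u v l m : hcvg u l -> hcvg v m ->
  (fun n => rip (u n) (v n)) @ \oo --> rip l m.
Proof.
move=> hu hv; rewrite rip_polar.
have -> : (fun n => rip (u n) (v n)) =
    (fun n => (hnorm (u n + v n) ^+ 2 - hnorm (u n - v n) ^+ 2) / 4).
  by apply/funext => n; exact: rip_polar.
apply: cvgM; last exact: cvg_cst.
apply: cvgB; rewrite expr2.
  by under eq_fun do rewrite expr2; apply: cvgM; apply: hcvg_norm; exact: hcvgD.
by under eq_fun do rewrite expr2; apply: cvgM; apply: hcvg_norm; exact: hcvgB.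
Qed.

Lemma rip_sep x y : (forall z, rip x z = rip y z) -> x = y.
Proof.
move=> h; apply/eqP; rewrite -subr_eq0; apply/eqP; apply: rip_eq0.
by rewrite ripBl h subrr.
Qed.

End One.

Section Ops.
Variables H K : hilbertType R.

Definition clinear (f : H -> K) := forall (a : C) (x y : H), f (a *: x + y) = a *: f x + f y.

Section Lin.
Variable f : H -> K.
Hypothesis fl : clinear f.
Lemma clin0 : f 0 = 0.
Proof.
have := fl 1 0 0; rewrite scaler0 addr0 scale1r => h.
by apply: (addrI (f 0)); rewrite -h addr0.
Qed.
Lemma clinD x y : f (x + y) = f x + f y.
Proof. by rewrite -{1}(scale1r x) fl scale1r. Qed.
Lemma clinZ a x : f (a *: x) = a *: f x.
Proof. by rewrite -(addr0 (a *: x)) fl clin0 addr0. Qed.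
Lemma clinN x : f (- x) = - f x. Proof. by rewrite -(scaleN1r x) clinZ scaleN1r. Qed.
Lemma clinB x y : f (x - y) = f x - f y. Proof. by rewrite clinD clinN. Qed.
Lemma clin_sum (I : Type) (r : seq I) (F : I -> H) :
  f (\sum_(i <- r) F i) = \sum_(i <- r) f (F i).
Proof. by elim/big_rec2: _ => [|i y x _ <-]; rewrite ?clin0 ?clinD. Qed.
End Lin.

Lemma bop_lin (f : H -> K) : bounded_op f -> clinear f. Proof. by case. Qed.

Lemma bop_bound (f : H -> K) : bounded_op f ->
  exists2 M : R, 0 < M & forall x, hnorm (f x) <= M * hnorm x.
Proof.
move=> [_ [M hM]]; exists (`|M| + 1); first by rewrite ltr_wpDl.
move=> x; apply: le_trans (hM x) _; apply: ler_wpM2r; first exact: hn_ge0.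
by apply: le_trans (ler_norm _) _; rewrite lerDl.
Qed.

Lemma hcvg_op (f : H -> K) u l : bounded_op f -> hcvg u l -> hcvg (fun n => f (u n)) (f l).
Proof.
move=> fb; have [M _ hM] := bop_bound fb; move=> hu.
apply: hcvg_le (seq_cvgM0 M hu) => n; rewrite -(clinB (bop_lin fb)); exact: hM.
Qed.
End Ops.

Lemma bop_comp (H K L : hilbertType R) (f : H -> K) (g : K -> L) :
  bounded_op f -> bounded_op g -> bounded_op (fun x => g (f x)).
Proof.
move=> fb gb; split; first by move=> a x y; rewrite (bop_lin fb) (bop_lin gb).
have [M _ hM] := bop_bound fb; have [N N0 hN] := bop_bound gb.
exists (N * M) => x; apply: le_trans (hN _) _.
by rewrite -mulrA ler_pM2l.
Qed.

Lemma bop_scale (H K : hilbertType R) (a : C) (f : H -> K) :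
  bounded_op f -> bounded_op (fun x => a *: f x).
Proof.
move=> fb; split.
  by move=> b x y; rewrite (bop_lin fb) scalerDr !scalerA mulrC.
have [M M0 hM] := bop_bound fb; exists (Re `|a| * M) => x.
rewrite hnZ -mulrA ler_wpM2l //.
by case: a => ? ?; exact: sqrtr_ge0.
Qed.

Lemma bop_id (H : hilbertType R) : bounded_op (fun x : H => x).
Proof. by split => //; exists 1 => x; rewrite mul1r. Qed.

Lemma inverse_bounded (H : hilbertType R) (V W : H -> H) : invertible_op V ->
  (forall x, W (V x) = x) -> bounded_op W.
Proof.
move=> [_ [W' [W'b VW' _]]] WV; suff -> : W = W' by [].
by apply/funext => x; rewrite -{1}(VW' x) WV.
Qed.

End HilbertBasics.

(** * Subspaces as modules *)

Section Submodule.
Variables (A : pzRingType) (U : lmodType A) (P : U -> Prop).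
Hypotheses (P0 : P 0) (Plin : forall a x y, P x -> P y -> P (a *: x + y)).

Definition submod_pred : {pred U} := fun x => `[< P x >].

Let submod_pred_closed : submod_closed submod_pred.
Proof.
split; first exact/asboolP.
by move=> a x y /asboolP Px /asboolP Py; apply/asboolP; exact: Plin.
Qed.
HB.instance Definition _ := GRing.isSubmodClosed.Build _ _ submod_pred submod_pred_closed.

Record submod_type := SubmodType { submod_val : U ; _ : submod_val \in submod_pred }.
HB.instance Definition _ := [isSub for submod_val].
HB.instance Definition _ := [Choice of submod_type by <:].
HB.instance Definition _ := [SubChoice_isSubLmodule of submod_type by <:].

(** Provides the carrier of the completion, which is given as a predicate on functions. *)
Lemma submodule_exists : exists (W : lmodType A) (v : W -> U),
  [/\ (forall a x y, v (a *: x + y) = a *: v x + v y), injective v,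
      (forall w, P (v w)) & (forall u, P u -> exists w, v w = u)].
Proof.
exists submod_type, submod_val; split.
- by move=> a x y; rewrite -[submod_val]/(val) linearP.
- exact: val_inj.
- by move=> w; apply/asboolP; exact: (valP w).
- by move=> u /asboolP Pu; exists (SubmodType Pu).
Qed.
End Submodule.

(** * Hilbert completion *)

Section Completion.
Variable R : realType.
Local Notation C := R[i].
Local Notation Re := complex.Re.
Local Notation Im := complex.Im.

Definition ccvg (z : nat -> C) (l : C) :=
  (fun n => Re (z n)) @ \oo --> Re l /\ (fun n => Im (z n)) @ \oo --> Im l.

Lemma ccvg_cst l : ccvg (fun=> l) l. Proof. by split; exact: cvg_cst. Qed.
Lemma ccvg_uniq z l m : ccvg z l -> ccvg z m -> l = m.
Proof. by move=> [? ?] [? ?]; apply: complex_ext; apply: seq_cvg_uniq; eassumption. Qed.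
Lemma ccvgD z w l m : ccvg z l -> ccvg w m -> ccvg (fun n => z n + w n) (l + m).
Proof.
move=> [h1 h2] [h3 h4]; split; rewrite ?cReD ?cImD.
  by under eq_fun do rewrite cReD; exact: cvgD.
by under eq_fun do rewrite cImD; exact: cvgD.
Qed.
Lemma ccvgM a z l : ccvg z l -> ccvg (fun n => a * z n) (a * l).
Proof.
move=> [h1 h2]; split; rewrite ?cReM ?cImM.
  under eq_fun do rewrite cReM.
  by apply: cvgB; apply: cvgM => //; exact: cvg_cst.
under eq_fun do rewrite cImM.
by apply: cvgD; apply: cvgM => //; exact: cvg_cst.
Qed.
Lemma ccvgJ z l : ccvg z l -> ccvg (fun n => conjc (z n)) (conjc l).
Proof.
move=> [h1 h2]; split; rewrite ?cReJ ?cImJ.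
  by under eq_fun do rewrite cReJ.
by under eq_fun do rewrite cImJ; exact: cvgN.
Qed.

Variables (V : Type) (v0 : V) (add : V -> V -> V) (scl : C -> V -> V) (s : V -> V -> C).
Hypothesis hs : semi_inner add scl s.
Local Notation q := (seminorm s).
Local Notation sub x y := (add x (scl (-1) y)).
Let sDl := sinDl hs. Let sZl := sinZl hs. Let sDr := sinDr hs. Let sZr := sinZr hs.

Lemma ssubl x y z : s (sub x y) z = s x z - s y z.
Proof. by rewrite sDl sZl mulN1r. Qed.

Lemma sn_ext x y : (forall z, s x z = s y z) -> q x = q y.
Proof. by move=> h; rewrite /seminorm h (sinC hs) h -(sinC hs). Qed.

Definition scauchy (u : nat -> V) := forall eps : R, 0 < eps -> exists N : nat,
  forall m n : nat, (N <= m)%N -> (N <= n)%N -> q (sub (u m) (u n)) < eps.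

Lemma scauchy_sn u : scauchy u -> exists l : R, (fun n => q (u n)) @ \oo --> l.
Proof.
move=> h; apply: seq_cauchy_cvg => eps /h [N hN].
by exists N => m n Nm Nn; apply: le_lt_trans (hN _ _ Nm Nn); exact: (sn_dist hs).
Qed.

Lemma scauchy_cst x : scauchy (fun=> x).
Proof.
move=> eps e0; exists 0 => m n _ _; suff -> : q (sub x x) = 0 by [].
apply/eqP; rewrite -sqrf_eq0 (sn_sqr hs) ssubl subrr; exact/eqP.
Qed.

Lemma scauchy_lin a u v : scauchy u -> scauchy v ->
  scauchy (fun n => add (scl a (u n)) (v n)).
Proof.
move=> hu hv eps e0; set c := Re `|a|.
have c0 : 0 <= c by rewrite /c; case: (a) => ? ?; exact: sqrtr_ge0.
have e20 : 0 < eps / 2 by rewrite divr_gt0.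
have [N hN] := hu _ (divr_gt0 e20 (ltr_wpDl c0 ltr01)).
have [M hM] := hv _ e20; exists (maxn N M) => m n.
rewrite !geq_max => /andP[Nm Mm] /andP[Nn Mn].
have -> : q (sub (add (scl a (u m)) (v m)) (add (scl a (u n)) (v n))) =
          q (add (scl a (sub (u m) (u n))) (sub (v m) (v n))).
  by apply: sn_ext => z; rewrite !(sDl, sZl); ring.
apply: le_lt_trans (sn_add hs _ _) _; rewrite (sn_scl hs) -/c (splitr eps).
apply: ler_ltD; last exact: hM.
have h := hN _ _ Nm Nn; rewrite ltr_pdivlMr ?ltr_wpDl // in h.
by apply: ltW; apply: le_lt_trans h; rewrite mulrDr mulr1 [c * _]mulrC lerDl sn_ge0.
Qed.

Lemma sin_polar x y : Re (s x y) = (q (add (scl 1 x) y) ^+ 2 - q (add (scl (-1) x) y) ^+ 2) / 4.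
Proof.
rewrite !(sn_sqr hs) !(sDl, sZl, sDr, sZr) !reimE (cReC hs x y).
by field.
Qed.

Lemma sin_cvg u v : scauchy u -> scauchy v -> exists l, ccvg (fun n => s (u n) (v n)) l.
Proof.
move=> hu hv.
have key w : scauchy w -> exists l : R, (fun n => Re (s (w n) (v n))) @ \oo --> l.
  move=> hw.
  have [l1 h1] := scauchy_sn (scauchy_lin 1 hw hv).
  have [l2 h2] := scauchy_sn (scauchy_lin (-1) hw hv).
  exists ((l1 * l1 - l2 * l2) / 4); under eq_fun do rewrite sin_polar !expr2.
  apply: cvgM; last exact: cvg_cst.
  by apply: cvgB; apply: cvgM.
have [a ha] := key _ hu.
have [b hb] := key _ (scauchy_lin (- 'i%C - 1) hu hu).
exists (a +i* b)%C; split => //=.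
suff -> : (fun n => Im (s (u n) (v n))) =
  (fun n => Re (s (add (scl (- 'i%C - 1) (u n)) (u n)) (v n))) by [].
apply/funext => n; rewrite (Im_sinE hs) !(sDl, sZl).
by congr Re; ring.
Qed.

(** A point of the completion is encoded by the functional that it induces on [V]. Functions are
    compared extensionally, so Cauchy sequences need not be quotiented, and [V -> C^o] already is a
    module. *)
Definition represents (u : nat -> V) (phi : V -> C^o) :=
  scauchy u /\ forall v, ccvg (fun n => s (u n) v) (phi v).

Definition limit_functional (phi : V -> C^o) := exists u, represents u phi.

Lemma represents_cauchy u : scauchy u -> exists phi, represents u phi.
Proof.
move=> hu; have /choice [phi hphi] := fun v => sin_cvg hu (scauchy_cst v).
by exists phi.
Qed.

Lemma represents_lin a u v phi psi : represents u phi -> represents v psi ->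
  represents (fun n => add (scl a (u n)) (v n)) (a *: phi + psi).
Proof.
move=> [hu hphi] [hv hpsi]; split; first exact: scauchy_lin.
move=> w; have -> : (fun n => s (add (scl a (u n)) (v n)) w) =
  (fun n => a * s (u n) w + s (v n) w) by apply/funext => n; rewrite sDl sZl.
by apply: ccvgD; first exact: ccvgM.
Qed.

(** A weakly null Cauchy sequence is null in norm: with L the limit of the norms and N such that
    [u n] stays within L / 2 of [u N], splitting <u_n, u_n> = <u_n, u_n - u_N> + <u_n, u_N> gives
    L^2 <= L^2 / 2 in the limit. *)
Lemma represents_null u : represents u 0 -> (fun n => q (u n)) @ \oo --> (0 : R).
Proof.
move=> [hu h0]; have [L hL] := scauchy_sn hu.
have L0 : 0 <= L by apply: (seq_cvg_le (cvg_cst _) hL) => n; exact: sn_ge0.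
suff -> : 0 = L :> R by [].
apply/eqP; rewrite eq_le L0 andTb leNgt; apply/negP => Lp.
have [N hN] := hu _ (divr_gt0 Lp (ltr0n _ 2)).
have : L * L <= L * (L / 2) + 0.
  have h1 : (fun n => q (u (n + N)%N)) @ \oo --> L by move: hL; rewrite -(cvg_shiftn N).
  have h2 : (fun n => Re (s (u (n + N)%N) (u N))) @ \oo --> (0 : R).
    by have [+ _] := h0 (u N); rewrite -(cvg_shiftn N).
  apply: (seq_cvg_le (cvgM h1 h1) (cvgD (cvgM h1 (cvg_cst (L / 2))) h2)) => n.
  rewrite -[leLHS]expr2 (sn_sqr hs).
  have -> : Re (s (u (n + N)%N) (u (n + N)%N)) =
    Re (s (u (n + N)%N) (sub (u (n + N)%N) (u N))) + Re (s (u (n + N)%N) (u N)).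
    by rewrite -cReD sDr sZr rmorphN1; congr Re; ring.
  rewrite lerD2r; apply: le_trans (ler_norm _) _; apply: le_trans (Re_sin_le hs _ _) _.
  apply: ler_wpM2l; first exact: sn_ge0.
  by apply/ltW/hN; rewrite ?leq_addl.
by rewrite addr0 ler_pM2l // => h; lra.
Qed.

(** Makes the inner product of functionals independent of the representing sequences: two
    representatives differ by a sequence that is null by [represents_null]. *)
Lemma represents_sin u u' v v' phi psi l :
  represents u phi -> represents u' phi -> represents v psi -> represents v' psi ->
  ccvg (fun n => s (u n) (v n)) l -> ccvg (fun n => s (u' n) (v' n)) l.
Proof.
have null w w' chi : represents w chi -> represents w' chi ->
    (fun n => q (sub (w n) (w' n))) @ \oo --> (0 : R).
  move=> hw hw'.
  have := represents_null; move: (represents_lin (-1) hw' hw); rewrite scaleN1r addNr.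
  move=> h /(_ _ h); apply: seq_cvg_ext => n.
  by apply: sn_ext => z; rewrite !(sDl, sZl); ring.
move=> hu hu' hv hv' hl.
have [L hL] := scauchy_sn hv.1; have [L' hL'] := scauchy_sn hu'.1.
have bnd : (fun n => q (sub (u n) (u' n)) * q (v n) + q (u' n) * q (sub (v n) (v' n)))
     @ \oo --> (0 : R).
  have := cvgD (cvgM (null _ _ _ hu hu') hL) (cvgM hL' (null _ _ _ hv hv')).
  by rewrite mul0r mulr0 addr0 => h; exact: h.
have e n : s (u' n) (v' n) = s (u n) (v n) - (s (sub (u n) (u' n)) (v n) + s (u' n) (sub (v n) (v' n))).
  by rewrite !(sDl, sZl, sDr, sZr) rmorphN1; ring.
have d : ccvg (fun n => s (sub (u n) (u' n)) (v n) + s (u' n) (sub (v n) (v' n))) 0.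
  split; apply: seq_cvg0_le bnd => n; rewrite ?cReD ?cImD.
    by apply: le_trans (ler_normD _ _) _; apply: lerD; exact: (Re_sin_le hs).
  by apply: le_trans (ler_normD _ _) _; apply: lerD; exact: (Im_sin_le hs).
have := ccvgD hl (ccvgM (-1) d); rewrite mulr0 addr0.
by congr ccvg; apply/funext => n; rewrite e mulN1r.
Qed.

Lemma completion : exists (K : hilbertType R) (j : V -> K),
  [/\ (forall x y, j (add x y) = j x + j y),
      (forall a x, j (scl a x) = a *: j x),
      (forall x y, hinner (j x) (j y) = s x y) &
      (forall (k : K) (eps : R), 0 < eps -> exists v, hnorm (k - j v) < eps)].
Proof.
have P0 : limit_functional 0.
  exists (fun=> scl 0 v0); split; first exact: scauchy_cst.
  by move=> v; under eq_fun do rewrite sZl mul0r; exact: ccvg_cst.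
have Plin a x y : limit_functional x -> limit_functional y -> limit_functional (a *: x + y).
  by move=> [u hu] [v hv]; exists (fun n => add (scl a (u n)) (v n)); exact: represents_lin.
have [W [val [vlin vinj vP vsurj]]] := submodule_exists P0 Plin.
have v00 : val 0 = 0.
  have := vlin 1 0 0; rewrite scaler0 addr0 scale1r => h.
  by apply: (addrI (val 0)); rewrite -h addr0.
have /choice [r hr] : forall w, exists u, represents u (val w) by exact: vP.
have /choice [ip0 hip0] : forall w : W * W, exists l, ccvg (fun n => s (r w.1 n) (r w.2 n)) l.
  by move=> [w w']; exact: sin_cvg (hr w).1 (hr w').1.
pose ip w w' := ip0 (w, w').
have hip w w' u u' : represents u (val w) -> represents u' (val w') ->
    ccvg (fun n => s (u n) (u' n)) (ip w w').
  by move=> hu hu'; apply: represents_sin (hip0 (w, w')) => //; exact: hr.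
have ipn w u : represents u (val w) -> (fun n => q (u n)) @ \oo --> ip_norm ip w.
  move=> hu; rewrite /ip_norm.
  apply: (@continuous_cvg _ _ _ _ _ _ (@Num.sqrt R)); first exact: sqrt_continuous.
  by have [] := hip _ _ _ _ hu hu.
have ax : inner_product_axioms ip.
  split.
  - move=> a x y z.
    have h : represents (fun n => add (scl a (r x n)) (r y n)) (val (a *: x + y)).
      by rewrite vlin; exact: represents_lin.
    apply: ccvg_uniq (hip _ _ _ _ h (hr z)) _.
    under eq_fun do rewrite sDl sZl.
    by apply: ccvgD; [apply: ccvgM|]; apply: hip.
  - move=> x y; apply: ccvg_uniq (hip _ _ _ _ (hr y) (hr x)) _.
    under eq_fun do rewrite (sinC hs).
    by apply: ccvgJ; apply: hip.
  - move=> x; have [h _] := hip _ _ _ _ (hr x) (hr x).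
    by apply: (seq_cvg_le (cvg_cst _) h) => n; exact: (sin_ge0 hs).
  - move=> x hx; apply: vinj; rewrite v00; apply/funext => v.
    have q0 : (fun n => q (r x n)) @ \oo --> (0 : R).
      by have := ipn _ _ (hr x); rewrite /ip_norm hx sqrtr0.
    have e0 : (fun n => q v * q (r x n)) @ \oo --> (0 : R) by exact: seq_cvgM0.
    apply: ccvg_uniq ((hr x).2 v) _.
    split; apply: seq_cvg0_le e0 => n; rewrite mulrC.
      exact: (Re_sin_le hs).
    exact: (Im_sin_le hs).
have /choice [j hj] : forall v, exists w, val w = s v.
  move=> v; apply: vsurj; exists (fun=> v); split; first exact: scauchy_cst.
  by move=> w; exact: ccvg_cst.
have hjr v : represents (fun=> v) (val (j v)).
  by split; [exact: scauchy_cst|move=> w; rewrite hj; exact: ccvg_cst].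
have dist w u m : represents u (val w) ->
    (fun n => q (sub (u n) (u m))) @ \oo --> ip_norm ip (w - j (u m)).
  move=> hu; have h : represents (fun n => add (scl (-1) (u m)) (u n)) (val (w - j (u m))).
    by rewrite addrC -scaleN1r vlin; exact: represents_lin.
  have := ipn _ _ h; apply: seq_cvg_ext => n.
  by apply: sn_ext => z; rewrite !(sDl, sZl) addrC.
have dense w u : represents u (val w) -> forall eps : R, 0 < eps ->
    exists N : nat, forall n, (N <= n)%N -> ip_norm ip (w - j (u n)) < eps.
  move=> hu eps e0; have [N hN] := hu.1 _ (divr_gt0 e0 (ltr0n _ 2)).
  exists N => n Nn; apply: (@le_lt_trans _ _ (eps / 2)); last by lra.
  have h := dist w u n hu; rewrite -(cvg_shiftn N) in h.
  by apply: (seq_cvg_lec h) => k; apply/ltW/hN => //; rewrite leq_addl.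
have jlin a x y : j (add (scl a x) y) = a *: j x + j y.
  by apply: vinj; rewrite vlin !hj; apply/funext => z; rewrite sDl sZl.
have wsin := inner_product_semi ax.
have nD x y : ip_norm ip (x + y) <= ip_norm ip x + ip_norm ip y := sn_add wsin x y.
have nB x y : ip_norm ip (x - y) = ip_norm ip (y - x).
  by rewrite -(opprB y x) -(scaleN1r (y - x)); exact: (sn_opp wsin).
have nT z x y : ip_norm ip (x - y) <= ip_norm ip (x - z) + ip_norm ip (z - y).
  by rewrite -{1}(subrK z x) -addrA nD.
have ipj x y : ip (j x) (j y) = s x y.
  exact: ccvg_uniq (hip _ _ _ _ (hjr x) (hjr y)) (ccvg_cst _).
have qj x y : q (sub x y) = ip_norm ip (j x - j y).
  by rewrite addrC -scaleN1r -jlin /ip_norm ipj; apply: sn_ext => z; rewrite !(sDl, sZl) addrC.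
have cmpl : ip_complete ip.
  move=> w hw.
  (* Diagonal argument: each [w n] is replaced by an embedded vector within 1 / (n + 1). The
     resulting sequence is Cauchy in [V], and the functional that it represents is the limit
     sought. *)
  have /choice [u hu] : forall n, exists v, ip_norm ip (w n - j v) < n.+1%:R^-1.
    move=> n; have e0 : (0 : R) < n.+1%:R^-1 by rewrite invr_gt0.
    by have [N /(_ N (leqnn N)) hN] := dense _ _ (hr (w n)) _ e0; exists (r (w n) N).
  have small (eps : R) : 0 < eps -> exists N : nat, forall n, (N <= n)%N -> ip_norm ip (w n - j (u n)) < eps.
    move=> e0; have /seq_cvgP /(_ _ e0) [N hN] := @harmonic_cvg0 R.
    exists N => n /hN; rewrite subr0 ger0_norm ?invr_ge0 //; exact: lt_trans (hu n).
  have cu : scauchy u.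
    move=> eps e0; have e3 : 0 < eps / 3 by rewrite divr_gt0.
    have [N1 h1] := small _ e3; have [N2 h2] := hw _ e3.
    exists (maxn N1 N2) => m n; rewrite !geq_max => /andP[m1 m2] /andP[n1 n2].
    rewrite qj; have := h1 _ m1; have := h1 _ n1; have := h2 _ _ m2 n2.
    have := nT (w m) (j (u m)) (j (u n)); have := nT (w n) (w m) (j (u n)).
    by rewrite (nB (j (u m)) (w m)); lra.
  have [phi hphi] := represents_cauchy cu.
  have [l hl] := vsurj phi (ex_intro _ u hphi).
  exists l => eps e0; have e2 : 0 < eps / 2 by rewrite divr_gt0.
  have [N1 h1] := small _ e2.
  have hu' : represents u (val l) by rewrite hl.
  have [N2 h2] := dense _ _ hu' _ e2.
  exists (maxn N1 N2) => n; rewrite geq_max => /andP[n1 n2].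
  have := nT (j (u n)) (w n) l.
  by have := h1 _ n1; have := h2 _ n2; rewrite (nB l); lra.
exists (HilbertType ax cmpl), j; split.
- by move=> x y; apply: vinj; rewrite -(scale1r (j x)) vlin !hj; apply/funext => z; rewrite sDl scale1r.
- by move=> a x; apply: vinj; rewrite -(addr0 (a *: j x)) vlin !hj v00 addr0; apply/funext => z; rewrite sZl.
- exact: ipj.
- move=> k eps e0; have [N /(_ N (leqnn N)) hN] := dense _ _ (hr k) _ e0.
  by exists (r k N).
Qed.
End Completion.

(** * Hilbert spaces of positive kernels *)

Section Dilation.
Variable R : realType.
Local Notation C := R[i].
Local Notation Re := complex.Re.

Lemma cRe_sum (I : Type) (r : seq I) (F : I -> C) :
  Re (\sum_(i <- r) F i) = \sum_(i <- r) Re (F i).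
Proof. by elim/big_rec2: _ => [//|i y x _ <-]; rewrite cReD. Qed.

Lemma rip_suml (H : hilbertType R) (I : Type) (r : seq I) (F : I -> H) y :
  rip (\sum_(i <- r) F i) y = \sum_(i <- r) rip (F i) y.
Proof. by elim/big_rec2: _ => [|i z x _ <-]; rewrite ?rip0l ?ripDl. Qed.

Lemma rip_sumr (H : hilbertType R) (I : Type) (r : seq I) (F : I -> H) y :
  rip y (\sum_(i <- r) F i) = \sum_(i <- r) rip y (F i).
Proof. by rewrite ripC rip_suml; apply: eq_bigr => i _; rewrite ripC. Qed.

Section Lsum.
Variables (I : Type) (H K : hilbertType R).
Implicit Types (Phi : I -> H -> K) (l : seq (I * H)).

Definition lsum Phi l : K := \sum_(p <- l) Phi p.1 p.2.
Definition lscale (a : C) l := [seq (p.1, a *: p.2) | p <- l].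

Lemma lsum_cat Phi l l' : lsum Phi (l ++ l') = lsum Phi l + lsum Phi l'.
Proof. exact: big_cat. Qed.

Lemma lsum_scale Phi a l : (forall i, clinear (Phi i)) ->
  lsum Phi (lscale a l) = a *: lsum Phi l.
Proof.
move=> h; rewrite /lsum big_map scaler_sumr; apply: eq_bigr => p _ /=.
exact: clinZ.
Qed.

Lemma lsum1 Phi i x : lsum Phi [:: (i, x)] = Phi i x.
Proof. by rewrite /lsum big_seq1. Qed.

Definition total_family Phi := forall (k : K) (eps : R), 0 < eps ->
  exists l, hnorm (k - lsum Phi l) < eps.

Lemma total_cvg Phi k : total_family Phi -> exists u, hcvg (fun n => lsum Phi (u n)) k.
Proof.
move=> h; have /choice [u hu] : forall n, exists l, hnorm (k - lsum Phi l) < n.+1%:R^-1.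
  by move=> n; apply: h; rewrite invr_gt0.
exists u; apply: hcvg_le (@harmonic_cvg0 R) => n; rewrite hnB; exact/ltW.
Qed.
End Lsum.

(** Formal sums of terms [(i, x)] carry the form defined by the kernel; completing them kills its
    null vectors. Only the first argument of [ker] is assumed linear, the second follows by
    Hermitian symmetry. *)
Lemma kernel_dilation (I : Type) (H : hilbertType R) (ker : I -> I -> H -> H -> C) :
  (forall s t a x y z, ker s t (a *: x + y) z = a * ker s t x z + ker s t y z) ->
  (forall s t x y, ker t s y x = conjc (ker s t x y)) ->
  (forall l : seq (I * H), 0 <= \sum_(p <- l) \sum_(r <- l) Re (ker p.1 r.1 p.2 r.2)) ->
  exists (K : hilbertType R) (Phi : I -> H -> K),
    [/\ (forall s, clinear (Phi s)), total_family Phi &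
        (forall s t x y, hinner (Phi s x) (Phi t y) = ker s t x y)].
Proof.
move=> kl kc k0.
pose s (l l' : seq (I * H)) := \sum_(p <- l) \sum_(r <- l') ker p.1 r.1 p.2 r.2.
have k00 u v z : ker u v 0 z = 0.
  have := kl u v 1 0 0 z; rewrite scaler0 addr0 mul1r => h.
  by apply: (addrI (ker u v 0 z)); rewrite -h addr0.
have hs : semi_inner cat (@lscale I H) s.
  split.
  - by move=> x y z; rewrite /s big_cat.
  - move=> a x z; rewrite /s big_map big_distrr /=; apply: eq_bigr => p _.
    rewrite big_distrr /=; apply: eq_bigr => r _.
    by rewrite -(addr0 (a *: p.2)) kl k00 addr0.
  - move=> x y; rewrite /s exchange_big /= rmorph_sum /=; apply: eq_bigr => p _.
    by rewrite rmorph_sum; apply: eq_bigr => r _; rewrite kc.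
  - move=> x; rewrite cRe_sum; under eq_bigr do rewrite cRe_sum; exact: k0.
have [K [j [jD jZ jip jdense]]] := completion [::] hs.
pose Phi i x := j [:: (i, x)].
have Plin i : clinear (Phi i).
  move=> a x y; rewrite /Phi -jZ -jD; apply: rip_sep => z.
  (* On lists [Phi i] is linear only up to null vectors: the defect is orthogonal to every [j v],
     hence by density to every [z]. *)
  have zero w : (forall eps : R, 0 < eps -> exists v, `|rip w z| <= hnorm w * eps + `|rip w (j v)|) ->
      (forall v, rip w (j v) = 0) -> rip w z = 0.
    move=> h1 h2; apply/eqP; rewrite -normr_le0; apply/ler_addgt0Pl => e e0.
    have h : 0 < hnorm w + 1 by rewrite ltr_wpDl // hn_ge0.
    have [v] := h1 _ (divr_gt0 e0 h); rewrite h2 normr0 addr0 addr0 => /le_trans; apply.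
    rewrite mulrA ler_pdivrMr // mulrDr mulr1 mulrC lerDl; exact/ltW.
  apply/eqP; rewrite -subr_eq0 -ripBl; apply/eqP; apply: zero => [eps e0|v].
    have [v hv] := jdense z _ e0; exists v.
    have -> : rip (j [:: (i, a *: x + y)] - j (lscale a [:: (i, x)] ++ [:: (i, y)])) z =
      rip (j [:: (i, a *: x + y)] - j (lscale a [:: (i, x)] ++ [:: (i, y)])) (z - j v) +
      rip (j [:: (i, a *: x + y)] - j (lscale a [:: (i, x)] ++ [:: (i, y)])) (j v).
      by rewrite -ripDr subrK.
    apply: le_trans (ler_normD _ _) _; rewrite lerD2r.
    apply: le_trans (norm_rip_le _ _) _; apply: ler_wpM2l; first exact: hn_ge0.
    exact: ltW.
  rewrite ripBl /rip !jip (sinDl hs) (sinZl hs); apply/eqP; rewrite subr_eq0; apply/eqP.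
  by congr Re; rewrite /s !big_seq1 mulr_sumr -big_split; apply: eq_bigr => p _; exact: kl.
exists K, Phi; split => //.
  move=> k eps e0; have [v hv] := jdense k _ e0; exists v; suff -> : lsum Phi v = j v by [].
  elim: (v) => [|[i x] l IH].
    rewrite /lsum big_nil; apply/esym/rip_eq0.
    by rewrite /rip jip /s big_nil.
  by rewrite -cat1s lsum_cat IH jD lsum1.
by move=> t u x y; rewrite /Phi jip /s !big_seq1.
Qed.

(** The bound on formal sums applies to differences of sums as well, so it carries Cauchy sequences
    to Cauchy sequences and makes the extension single-valued. *)
Lemma total_extension (I : Type) (H K K' : hilbertType R) (Phi : I -> H -> K)
    (Psi : I -> H -> K') (M : R) :
  0 <= M -> (forall i, clinear (Phi i)) -> (forall i, clinear (Psi i)) -> total_family Phi ->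
  (forall l, hnorm (lsum Psi l) <= M * hnorm (lsum Phi l)) ->
  exists F : K -> K', [/\ bounded_op F, (forall i x, F (Phi i x) = Psi i x) &
    (forall k, hnorm (F k) <= M * hnorm k)].
Proof.
move=> M0 Pl Ql tot bnd.
have bnd2 a l l' : hnorm (a *: lsum Psi l + lsum Psi l') <= M * hnorm (a *: lsum Phi l + lsum Phi l').
  by have := bnd (lscale a l ++ l'); rewrite !lsum_cat !lsum_scale.
(* The value is characterised by all approximating sequences at once, so linearity and the value at
   [Phi i x] follow by picking convenient ones. *)
have /choice [F hF] : forall k, exists k', forall u, hcvg (fun n => lsum Phi (u n)) k ->
    hcvg (fun n => lsum Psi (u n)) k'.
  move=> k; have [u hu] := total_cvg k tot.
  have cu : hcauchy (fun n => lsum Psi (u n)).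
    move=> eps e0; have M1 : 0 < M + 1 by rewrite ltr_wpDl.
    have [N hN] := hcvg_cauchy hu (divr_gt0 e0 M1).
    exists N => m n Nm Nn; have := hN m n Nm Nn; rewrite ltr_pdivlMr // => h.
    have := bnd2 (-1) (u n) (u m); rewrite !scaleN1r ![- _ + _]addrC => /le_lt_trans; apply.
    by apply: le_lt_trans h; rewrite mulrC mulrDr mulr1 lerDl hn_ge0.
  have [k' hk'] := hcauchy_cvg cu; exists k' => v hv.
  have h0 : hcvg (fun n => lsum Phi (v n) - lsum Phi (u n)) 0 by rewrite -(subrr k); exact: hcvgB.
  have h1 : hcvg (fun n => lsum Psi (v n) - lsum Psi (u n)) 0.
    apply: hcvg_le (seq_cvgM0 M h0) => n; rewrite !subr0.
    by have := bnd2 (-1) (u n) (v n); rewrite !scaleN1r ![- _ + _]addrC.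
  have := hcvgD h1 hk'; rewrite add0r; apply: hcvg_ext => n; exact: subrK.
have Fb k : hnorm (F k) <= M * hnorm k.
  have [u hu] := total_cvg k tot.
  have h1 := hcvg_norm (hF _ _ hu).
  have h2 : (fun n => M * hnorm (lsum Phi (u n))) @ \oo --> M * hnorm k.
    by apply: cvgM; [exact: cvg_cst|exact: hcvg_norm].
  exact: (seq_cvg_le h1 h2).
exists F; split => //.
  split; last by exists M.
  move=> a x y; have [u hu] := total_cvg x tot; have [v hv] := total_cvg y tot.
  have h : hcvg (fun n => lsum Phi (lscale a (u n) ++ v n)) (a *: x + y).
    apply: hcvg_ext (hcvgD (hcvgZ a hu) hv) => n.
    by rewrite lsum_cat lsum_scale.
  apply: hcvg_uniq (hF _ _ h) _.
  apply: hcvg_ext (hcvgD (hcvgZ a (hF _ _ hu)) (hF _ _ hv)) => n.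
  by rewrite lsum_cat lsum_scale.
move=> i x; apply: (@hcvg_uniq _ _ (fun=> Psi i x)); last exact: hcvg_cst.
apply: hcvg_ext (hF _ (fun=> [:: (i, x)]) _) => [n|]; first exact: lsum1.
by apply: hcvg_ext (hcvg_cst _) => n; rewrite lsum1.
Qed.

Lemma total_eq (I : Type) (H K K' : hilbertType R) (Phi : I -> H -> K) (F G : K -> K') :
  total_family Phi -> bounded_op F -> bounded_op G ->
  (forall i x, F (Phi i x) = G (Phi i x)) -> forall k, F k = G k.
Proof.
move=> tot Fb Gb h k; have [u hu] := total_cvg k tot.
apply: hcvg_uniq (hcvg_op Fb hu) _; apply: hcvg_ext (hcvg_op Gb hu) => n.
rewrite /lsum (clin_sum (bop_lin Fb)) (clin_sum (bop_lin Gb)).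
by apply: eq_bigr => p _; rewrite h.
Qed.

Lemma hnorm_lsum (I : Type) (H K : hilbertType R) (Phi : I -> H -> K) l :
  hnorm (lsum Phi l) ^+ 2 =
  \sum_(p <- l) \sum_(r <- l) rip (Phi p.1 p.2) (Phi r.1 r.2).
Proof.
by rewrite hn_sqr rip_suml; apply: eq_bigr => p _; rewrite rip_sumr.
Qed.

End Dilation.

(** * Orthogonal projection, Riesz representation, adjoints *)

Section Projection.
Variable R : realType.
Local Notation C := R[i].
Variable H : hilbertType R.
Implicit Types (x y z w : H) (Z : H -> Prop).

Lemma ripZr (a : C) x y : rip x (a *: y) = rip (conjc a *: x) y.
Proof. by rewrite ripZ conjcK. Qed.

(** [w] is the component of [x] orthogonal to the closure of [Z]. The closure enters through a
    sequence because [Z] will be a subspace of an algebraic span. For a complex subspace,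
    orthogonality for [rip] amounts to complex orthogonality. *)
Definition orth_part Z x w :=
  (forall z, Z z -> rip w z = 0) /\ exists u, (forall n : nat, Z (u n)) /\ hcvg u (x - w).

Definition real_subspace Z := Z 0 /\ forall (r : R) x y, Z x -> Z y -> Z ((r%:C)%C *: x + y).

Lemma orth_part_exists Z x : real_subspace Z -> exists w, orth_part Z x w.
Proof.
move=> [Z0 Zlin].
pose D := inf [set t : R | exists2 z, Z z & t = rip (x - z) (x - z)].
have hi : has_inf [set t : R | exists2 z, Z z & t = rip (x - z) (x - z)].
  split; first by exists (rip (x - 0) (x - 0)); exists 0.
  by exists 0 => _ [z _ ->]; exact: rip_ge0.
have Dle z : Z z -> D <= rip (x - z) (x - z).
  by move=> Zz; apply: ge_inf; [exact: hi.2|exists z].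
have /choice [u hu] : forall n, exists z, Z z /\ rip (x - z) (x - z) < D + n.+1%:R^-1.
  move=> n; have e0 : (0 : R) < n.+1%:R^-1 by rewrite invr_gt0.
  by have [_ [z Zz ->] lt] := inf_adherent e0 hi; exists z.
(* Parallelogram law: |u_m - u_n|^2 = 2 |x - u_m|^2 + 2 |x - u_n|^2 - 4 |x - h|^2, where the
   midpoint h lies in [Z] and so |x - h|^2 >= D. *)
have par m n : rip (u m - u n) (u m - u n) <= 2 * (m.+1%:R^-1 + n.+1%:R^-1).
  have Zh : Z (((2^-1)%:C)%C *: (u m) + ((2^-1)%:C)%C *: (u n)).
    apply: (Zlin); first exact: (hu m).1.
    by rewrite -[_ *: u n]addr0; apply: (Zlin) => //; exact: (hu n).1.
  have := Dle _ Zh; have := (hu m).2; have := (hu n).2.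
  rewrite !ripE (ripC (u m) x) (ripC (u n) x) (ripC (u n) (u m)).
  move: (m.+1%:R^-1) (n.+1%:R^-1) => em en. lra.
have cu : hcauchy u.
  move=> eps e0; have e2 : 0 < eps ^+ 2 / 4 by rewrite divr_gt0 // exprn_gt0.
  have /seq_cvgP /(_ _ e2) [N hN] := @harmonic_cvg0 R.
  exists N => m n /hN h1 /hN h2; rewrite -(@ltr_pXn2r _ 2) ?nnegrE ?hn_ge0 ?ltW //.
  rewrite hn_sqr; apply: le_lt_trans (par m n) _.
  by move: h1 h2; rewrite !subr0 !ger0_norm ?invr_ge0 //; move: (m.+1%:R^-1) (n.+1%:R^-1) => em en; lra.
have [l hl] := hcauchy_cvg cu.
have hxl y : hcvg (fun n => x - u n - y) (x - l - y).
  by apply: hcvgB (hcvg_cst _); exact: hcvgB (hcvg_cst _) hl.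
have rl : rip (x - l) (x - l) <= D.
  have h1 := hcvg_rip (hxl 0) (hxl 0).
  have h2 : (fun n => D + n.+1%:R^-1) @ \oo --> D + 0.
    by apply: cvgD; [exact: cvg_cst|exact: harmonic_cvg0].
  rewrite !subr0 addr0 in h1 h2; apply: (seq_cvg_le h1 h2) => n.
  by rewrite !subr0; apply: ltW; exact: (hu n).2.
exists (x - l); split; last by exists u; split; [move=> n; exact: (hu n).1|rewrite subKr].
move=> z Zz.
have key (r : R) : D <= rip (x - l - (r%:C)%C *: z) (x - l - (r%:C)%C *: z).
  have h1 := hcvg_rip (hxl ((r%:C)%C *: z)) (hxl ((r%:C)%C *: z)).
  apply: (seq_cvg_le (cvg_cst D) h1) => n.
  rewrite -addrA -opprD addrC -[- _ + x]addrC [u n + _]addrC.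
  by apply: Dle; apply: (Zlin) => //; exact: (hu n).1.
move: (x - l) rl key => v rl key; set b := rip v z; have c0 := rip_ge0 z; set c := rip z z in c0.
(* The optimal parameter would be b / c; dividing by c + 1 avoids the case z = 0 and still leaves a
   strictly negative multiple of b^2. *)
have := key (b / (c + 1)).
rewrite ripBl !ripBr !ripRl !ripRr (ripC z v) -/b -/c => h.
have {}h : 0 <= - 2 * (b / (c + 1)) * b + (b / (c + 1)) ^+ 2 * c.
  by rewrite expr2; lra.
have c1 : c + 1 != 0 by apply: lt0r_neq0; rewrite ltr_wpDl.
have e : - 2 * (b / (c + 1)) * b + (b / (c + 1)) ^+ 2 * c = - (b ^+ 2 * ((c + 2) / (c + 1) ^+ 2)).
  by field.
rewrite e oppr_ge0 pmulr_lle0 in h; last by rewrite divr_gt0 ?exprn_gt0 ?ltr_wpDl.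
by apply/eqP; rewrite -sqrf_eq0 eq_le h sqr_ge0.
Qed.

Lemma orth_part_orth Z x w y : (forall z, Z z -> rip y z = 0) -> orth_part Z x w ->
  rip y (x - w) = 0.
Proof.
move=> hy [_ [u [Zu hu]]].
apply: (seq_cvg_uniq (hcvg_rip (hcvg_cst y) hu)).
by under eq_fun do rewrite hy //; exact: cvg_cst.
Qed.

Lemma orth_part_min Z x w z : orth_part Z x w -> Z z -> hnorm w <= hnorm (x - z).
Proof.
move=> ho Zz; apply: hn_le_sqr (hn_ge0 _) _; rewrite hn_sqr.
have h1 := orth_part_orth ho.1 ho; have h2 := ho.1 _ Zz.
have h3 : rip w (x - w - z) = 0 by rewrite ripBr h1 h2 subr0.
have -> : x - z = w + (x - w - z) by rewrite [x - w]addrC -addrA addNKr.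
move: (x - w - z) h3 => t h3; rewrite ripDl !ripDr (ripC t w) h3.
by have := rip_ge0 t; lra.
Qed.

Lemma orth_part_approx Z x w (eps : R) : orth_part Z x w -> 0 < eps ->
  exists2 z, Z z & hnorm (x - z) < hnorm w + eps.
Proof.
move=> [_ [u [Zu /hcvgP hu]]] /hu [N /(_ N (leqnn N)) hN]; exists (u N) => //.
have -> : x - u N = w - (u N - (x - w)) by rewrite opprB [x - w]addrC -addrA addNKr.
by apply: le_lt_trans (hnD _ _) _; rewrite hnN ltrD2l.
Qed.

(** The difference of the two sides is orthogonal to [Z] and also lies in its closure, so it is
    orthogonal to itself. This yields uniqueness and linearity of the projection together. *)
Lemma orth_part_lin Z a x y w v t : Z 0 -> (forall (c : C) p q, Z p -> Z q -> Z (c *: p + q)) ->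
  orth_part Z x w -> orth_part Z y v -> orth_part Z (a *: x + y) t -> t = a *: w + v.
Proof.
move=> Z0 Zlin hx hy ht; apply/eqP; rewrite -subr_eq0; apply/eqP.
have Zs c z : Z z -> Z (c *: z) by move=> Zz; rewrite -(addr0 (c *: z)); exact: (Zlin).
have o z : Z z -> rip (t - (a *: w + v)) z = 0.
  move=> Zz; rewrite ripBl ripDl ripZ (ht.1 _ Zz) (hy.1 _ Zz) (hx.1 _ (Zs _ _ Zz)).
  by rewrite addr0 subrr.
apply: rip_eq0.
have e : t - (a *: w + v) = (a *: (x - w) + (y - v)) - (a *: x + y - t).
  rewrite scalerBr opprB [a *: x - _ + _]addrACA -opprD.
  by rewrite [RHS]addrC addrA subrK.
rewrite {2}e ripBr ripDr (orth_part_orth o ht) (orth_part_orth o hy) ripZr.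
rewrite (@orth_part_orth Z x w _ _ hx) ?addr0 ?subr0 // => z Zz.
by rewrite ripZ o //; exact: Zs.
Qed.

(** The representing vector is a multiple of the component, orthogonal to the kernel, of a vector on
    which [f] is nonzero. Stated for real-linear functionals to match [rip]; complex linearity of
    the operators built from it is read off their forms. *)
Lemma riesz (f : H -> R) (M : R) : (forall x y, f (x + y) = f x + f y) ->
  (forall (r : R) x, f ((r%:C)%C *: x) = r * f x) -> (forall x, `|f x| <= M * hnorm x) ->
  exists h, forall x, f x = rip h x.
Proof.
move=> fD fR fb.
have fB x y : f (x - y) = f x - f y.
  rewrite fD -scaleN1r; have := fR (-1) y; rewrite (_ : ((-1)%:C)%C = -1 :> C).
    by move=> ->; rewrite mulN1r.
  by rewrite rmorphN1.
have [f0|/existsNP [x0 hx0]] := pselect (forall x, f x = 0).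
  by exists 0 => x; rewrite rip0l f0.
have Zs : real_subspace (fun x => f x = 0).
  split; first by have := fB 0 0; rewrite subrr subrr.
  by move=> r x y hx hy; rewrite fD fR hx hy mulr0 addr0.
have [w hw] := orth_part_exists x0 Zs.
have fw : f w = f x0.
  have [_ [u [Zu hu]]] := hw; apply/eqP; rewrite eq_sym -subr_eq0 -fB; apply/eqP.
  have h : (fun n => f (u n) ) @ \oo --> f (x0 - w).
    apply: seq_cvg_dist (seq_cvgM0 M hu) => n; by rewrite -fB.
  by apply: (seq_cvg_uniq h); under eq_fun do rewrite Zu; exact: cvg_cst.
have fw0 : f w != 0 by rewrite fw; exact/eqP.
have ww : rip w w != 0.
  apply/eqP => /rip_eq0 w0; move: fw0; rewrite w0.
  by have := fB 0 0; rewrite !subrr => ->; rewrite eqxx.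
exists (((f w / rip w w)%:C)%C *: w) => x; rewrite ripRl.
have := hw.1 (x - ((f x / f w)%:C)%C *: w).
rewrite fB fR mulfVK // subrr => /(_ erefl); rewrite ripBr ripRr => /eqP.
rewrite subr_eq0 => /eqP ->; field.
by rewrite fw0 ww.
Qed.
End Projection.

Lemma adjoint_exists (R : realType) (H K : hilbertType R) (f : H -> K) : bounded_op f ->
  exists2 g : K -> H, bounded_op g & forall x y, rip (f x) y = rip x (g y).
Proof.
move=> fb; have [M M0 hM] := bop_bound fb; have fl := bop_lin fb.
have /choice [g hg] : forall y, exists h, forall x, rip (f x) y = rip h x.
  move=> y; apply: (@riesz _ _ _ (M * hnorm y)).
  - by move=> x z; rewrite (clinD fl) ripDl.
  - by move=> r x; rewrite (clinZ fl) ripRl.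
  - move=> x; apply: le_trans (norm_rip_le _ _) _.
    by rewrite mulrAC; apply: ler_wpM2r; [exact: hn_ge0|exact: hM].
exists g; last by move=> x y; rewrite hg ripC.
split.
  move=> a x y; apply: rip_sep => z.
  by rewrite -hg ripDr [RHS]ripDl [X in _ = X + _]ripZ -!hg (clinZ fl) ripZ conjcK.
exists M => y; have [->|n0] := eqVneq (hnorm (g y)) 0; first by rewrite mulr_ge0 ?hn_ge0 ?ltW.
rewrite -(@ler_pM2l _ (hnorm (g y))) ?lt_def ?n0 ?hn_ge0 // -expr2 hn_sqr -hg.
apply: le_trans (rip_le _ _) _; rewrite mulrA [_ * M]mulrC.
by apply: ler_wpM2r; [exact: hn_ge0|exact: hM].
Qed.

(** * Symmetric double sums over lists sorted by time *)

Section DoubleSums.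
Variable R : realType.

Definition dsum (T : Type) (f : T -> T -> R) (l : seq T) := \sum_(p <- l) \sum_(r <- l) f p r.

Lemma dsum_cons (T : Type) (f : T -> T -> R) p l : (forall p r, f p r = f r p) ->
  dsum f (p :: l) = f p p + 2 * (\sum_(r <- l) f p r) + dsum f l.
Proof.
move=> fC; rewrite /dsum big_cons big_cons.
under [X in _ + _ + X = _]eq_bigr do rewrite big_cons.
rewrite big_split /=; under [X in _ + _ + (X + _) = _]eq_bigr do rewrite fC.
by ring.
Qed.

Lemma dsum_perm (T : eqType) (f : T -> T -> R) l l' : perm_eq l l' -> dsum f l = dsum f l'.
Proof. by move=> h; rewrite /dsum (perm_big _ h); apply: eq_bigr => p _; rewrite (perm_big _ h). Qed.

Definition fst_le (T : Type) (p r : R * T) := p.1 <= r.1.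

Lemma sorted_wlog (T : eqType) (P : seq (R * T) -> Prop) :
  (forall l l', perm_eq l l' -> P l -> P l') ->
  (forall l, sorted (@fst_le T) l -> P l) -> forall l, P l.
Proof.
move=> Pperm Psort l; apply: (Pperm (sort (@fst_le T) l)); first by rewrite perm_sort.
by apply/Psort/sort_sorted => p r; exact: le_total.
Qed.

Lemma sorted_consP (T : eqType) p (l : seq (R * T)) : sorted (@fst_le T) (p :: l) ->
  sorted (@fst_le T) l /\ forall r, r \in l -> p.1 <= r.1.
Proof.
have tr : transitive (@fst_le T) by move=> y x z; exact: le_trans.
by rewrite /= path_sortedE // => /andP[/allP h ->]; split => // r /h.
Qed.
End DoubleSums.

(** * Strong continuity from a total family *)

Section StrongContinuity.
Variables (R : realType) (I : Type) (H K : hilbertType R) (Phi : I -> H -> K).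
Variables (D : R -> Prop) (F : R -> K -> K).

(** Contractivity transfers the error of approximating [k] by a finite sum. [D] selects the
    admissible times: nonnegative ones for the nilpotent semigroup, all of them for the unitary
    group. *)
Lemma total_continuity : total_family Phi -> (forall t, D t -> clinear (F t)) ->
  (forall t k, D t -> hnorm (F t k) <= hnorm k) ->
  (forall i x (eps : R), 0 < eps -> exists2 delta : R, 0 < delta &
     forall t, D t -> `|t| < delta -> hnorm (F t (Phi i x) - Phi i x) < eps) ->
  forall k (eps : R), 0 < eps -> exists2 delta : R, 0 < delta &
     forall t, D t -> `|t| < delta -> hnorm (F t k - k) < eps.
Proof.
move=> tot Fl Fc h.
have hl l (eps : R) : 0 < eps -> exists2 delta : R, 0 < delta &
     forall t, D t -> `|t| < delta -> hnorm (F t (lsum Phi l) - lsum Phi l) < eps.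
  elim: l eps => [|[i x] l IH] eps e0.
    exists 1 => // t Dt _; rewrite /lsum big_nil (clin0 (Fl t Dt)) subrr hn0 //.
  have e2 : 0 < eps / 2 by rewrite divr_gt0.
  have [d1 d10 h1] := h i x _ e2; have [d2 d20 h2] := IH _ e2.
  exists (Num.min d1 d2); first by rewrite lt_min d10.
  move=> t Dt; rewrite lt_min => /andP[/(h1 t Dt) {}h1 /(h2 t Dt) {}h2].
  rewrite -cat1s lsum_cat lsum1 (clinD (Fl t Dt)) opprD addrACA.
  by apply: le_lt_trans (hnD _ _) _; rewrite (splitr eps) ltrD.
move=> k eps e0; have e3 : 0 < eps / 3 by rewrite divr_gt0.
have [l hk] := tot k _ e3; have [d d0 hd] := hl l _ e3; exists d => // t Dt /(hd t Dt) {}hd.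
have := hn_triangle (F t (lsum Phi l)) (F t k) k.
have := hn_triangle (lsum Phi l) (F t (lsum Phi l)) k.
have := Fc t (k - lsum Phi l) Dt; rewrite (clinB (Fl t Dt)).
by move: hk hd; rewrite (hnB (lsum Phi l) k); lra.
Qed.
End StrongContinuity.

(** * Unitary dilation of a contraction semigroup *)

Section UnitaryDilation.
Variable R : realType.
Local Notation C := R[i].
Local Notation Re := complex.Re.
Variables (H : hilbertType R) (N : R -> H -> H).
Hypotheses (NC0 : C0_semigroup N)
  (Nc : forall t, 0 <= t -> forall x, hnorm (N t x) <= hnorm x).

Let Nl t : 0 <= t -> clinear (N t).
Proof. by case: NC0 => h _ _ _ /h /bop_lin. Qed.
Let N0 x : N 0 x = x. Proof. by case: NC0. Qed.
Let ND t s x : 0 <= t -> 0 <= s -> N (t + s) x = N t (N s x).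
Proof. by case: NC0 => _ _ h _; exact: h. Qed.

(** [Phi s x] is to become U(s) J x, which forces its inner products: <U(s) J x, U(t) J y> = <U(s -
    t) J x, J y> must be <N(s - t) x, y> for t <= s, and Hermitian symmetry gives the other case. *)
Definition dilation_kernel (s t : R) (x y : H) : C :=
  if t <= s then hinner (N (s - t) x) y else hinner x (N (t - s) y).

(* With [y(t) = \sum N (s_i - t) x_i] over the points [s_i >= t], the quadratic form of the
   points from [s] on is [|x + y'|^2 + (form of the later points) - |y'|^2]. *)
Lemma dilation_kernel_ge l t : sorted (@fst_le R H) l -> (forall p, p \in l -> t <= p.1) ->
  hnorm (\sum_(p <- l) N (p.1 - t) p.2) ^+ 2 <=
  dsum (fun p r => Re (dilation_kernel p.1 r.1 p.2 r.2)) l.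
Proof.
have sym p r : Re (dilation_kernel p.1 r.1 p.2 r.2) = Re (dilation_kernel r.1 p.1 r.2 p.2).
  rewrite /dilation_kernel; case: (ltgtP r.1 p.1) => [h|h|->].
  - exact: (cReC (hinner_semi H)).
  - exact: (cReC (hinner_semi H)).
  - by rewrite subrr !N0; exact: (cReC (hinner_semi H)).
elim: l t => [|[s x] l IH] t.
  by move=> _ _; rewrite big_nil hn0 expr0n /dsum big_nil.
move=> /sorted_consP /= [sl ml] mt; have {IH}:= IH s sl ml.
have st : 0 <= s - t by rewrite subr_ge0; exact: (mt (s, x) (mem_head _ _)).
set y := \sum_(p <- l) N (p.1 - s) p.2 => IH.
have -> : \sum_(p <- (s, x) :: l) N (p.1 - t) p.2 = N (s - t) (x + y).
  rewrite big_cons /= (clinD (Nl st)) (clin_sum (Nl st)); congr (_ + _).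
  apply: eq_big_seq => p pl; rewrite -ND // ?subr_ge0 ?ml //.
  by congr (N _ _); ring.
rewrite dsum_cons //=.
have -> : Re (dilation_kernel s s x x) = rip x x.
  by rewrite /dilation_kernel lexx subrr N0.
have -> : \sum_(r <- l) Re (dilation_kernel s r.1 x r.2) = rip x y.
  rewrite rip_sumr; apply: eq_big_seq => p /ml sp; rewrite /dilation_kernel.
  case: (ltgtP p.1 s) sp => // -> _.
  by rewrite subrr !N0.
have h : hnorm (N (s - t) (x + y)) ^+ 2 <= hnorm (x + y) ^+ 2.
  by rewrite ler_pXn2r ?nnegrE ?hn_ge0 ?Nc.
apply: le_trans h _; move: IH; rewrite !hn_sqr !ripDl !ripDr (ripC y x); lra.
Qed.

Lemma unitary_dilation : exists (K : hilbertType R) (J : H -> K) (P : K -> H) (U : R -> K -> K),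
  [/\ bounded_op J, bounded_op P, unitary_C0_group U &
      forall t, 0 <= t -> forall x, N t x = P (U t (J x))].
Proof.
have [K [Phi [Pl tot Pip]]] : exists (K : hilbertType R) (Phi : R -> H -> K),
    [/\ (forall s, clinear (Phi s)), total_family Phi &
        (forall s t x y, hinner (Phi s x) (Phi t y) = dilation_kernel s t x y)].
  apply: kernel_dilation.
  - move=> s t a x y z; rewrite /dilation_kernel; case: ifP => h.
      by rewrite Nl ?subr_ge0 // (sinDl (hinner_semi H)) (sinZl (hinner_semi H)).
    by rewrite (sinDl (hinner_semi H)) (sinZl (hinner_semi H)).
  - move=> s t x y; rewrite /dilation_kernel; case: (ltgtP t s) => h.
    + exact: (sinC (hinner_semi H)).
    + exact: (sinC (hinner_semi H)).
    + by rewrite h subrr !N0; exact: (sinC (hinner_semi H)).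
  - apply: sorted_wlog => [l l' ll'|l sl].
      by have := @dsum_perm R _ (fun p r => Re (dilation_kernel p.1 r.1 p.2 r.2)) _ _ ll'; rewrite /dsum => ->.
    have [t ht] : exists t, forall p, p \in l -> t <= p.1.
      elim: (l) => [|p l' [t ht]]; first by exists 0.
      exists (Num.min t p.1) => r; rewrite inE ge_min => /predU1P[->|/ht ->//].
      by rewrite lexx orbT.
    by apply: le_trans (dilation_kernel_ge sl ht); exact: sqr_ge0.
have Prip s t x y : rip (Phi s x) (Phi t y) = Re (dilation_kernel s t x y) by rewrite /rip Pip.
(* The kernel depends only on the difference of the times, so translating the times preserves all
   inner products and defines the group. *)
have shift r s t x y : rip (Phi (s + r) x) (Phi (t + r) y) = rip (Phi s x) (Phi t y).
  rewrite !Prip /dilation_kernel lerD2r.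
  by rewrite !(_ : forall a b : R, a + r - (b + r) = a - b) // => a b; ring.
have /choice [U hU] : forall r : R, exists F : K -> K,
    [/\ bounded_op F, (forall i x, F (Phi i x) = Phi (i + r) x) &
        (forall k, hnorm (F k) <= 1 * hnorm k)].
  move=> r; apply: (@total_extension _ _ _ _ _ Phi (fun i => Phi (i + r))) => // l.
  rewrite mul1r -(@ler_pXn2r _ 2) ?nnegrE ?hn_ge0 // !hn_sqr !rip_suml.
  apply: ler_sum => p _; rewrite !rip_sumr; apply: ler_sum => q _.
  by rewrite shift.
have Ub r : bounded_op (U r) by case: (hU r).
have Ul r : clinear (U r) by exact: bop_lin.
have UP r i x : U r (Phi i x) = Phi (i + r) x by case: (hU r).
have Uc r k : hnorm (U r k) <= hnorm k by case: (hU r) => _ _ /(_ k); rewrite mul1r.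
have U0 k : U 0 k = k.
  apply: (total_eq tot (Ub 0) (bop_id K)) => i x; by rewrite UP addr0.
have UD r s k : U (r + s) k = U r (U s k).
  apply: (total_eq tot (Ub _) (bop_comp (Ub s) (Ub r))) => i x; rewrite !UP.
  by congr Phi; ring.
(* A contraction whose inverse [U (- r)] is also a contraction is isometric. *)
have Un r k : hnorm (U r k) = hnorm k.
  apply/le_anti; rewrite Uc /= -{1}(U0 k) -(addNr r) UD; exact: Uc.
have Urip r k k' : rip (U r k) (U r k') = rip k k'.
  by rewrite !rip_polar -(clinD (Ul r)) -(clinB (Ul r)) !Un.
have Jb : bounded_op (Phi 0).
  split; first exact: Pl.
  exists 1 => x; rewrite mul1r; apply: hn_le_sqr (hn_ge0 _) _.
  by rewrite Prip /dilation_kernel lexx subrr N0 hn_sqr.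
have [P Pb PJ] := adjoint_exists Jb.
exists K, (Phi 0), P, U; split => //; last first.
  move=> t t0 x; apply: rip_sep => z; rewrite [RHS]ripC -PJ UP add0r [RHS]ripC Prip.
  by rewrite /dilation_kernel t0 subr0.
split => //.
  move=> t; split; first exact: Ul.
    by move=> x y; rewrite !hinnerE -(clinZ (Ul t)) !Urip.
  by move=> y; exists (U (- t) y); rewrite -UD subrr U0.
move=> k eps e0.
suff [d d0 hd] : exists2 delta : R, 0 < delta & forall t, True -> `|t| < delta -> hnorm (U t k - k) < eps.
  by exists d => // t; exact: hd.
apply: (total_continuity tot) e0 => //.
move=> i x {}eps e0.
(* The squared increment of [Phi i x] equals 2 <x - N(|t|) x, x>, at most 2 |x| |x - N(|t|) x|;
   hence the tolerance eps^2 / (2 |x| + 1). *)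
have c1 : 0 < 2 * hnorm x + 1 by rewrite ltr_wpDl ?mulr_ge0 ?hn_ge0.
have [_ _ _ /(_ x _ (divr_gt0 (exprn_gt0 2 e0) c1)) [d d0 hd]] := NC0.
exists d => // t _ td; rewrite UP -(@ltr_pXn2r _ 2) ?nnegrE ?hn_ge0 ?ltW //.
have -> : hnorm (Phi (i + t) x - Phi i x) ^+ 2 = 2 * rip (x - N `|t| x) x.
  rewrite hn_sqr !ripBl !ripBr !Prip /dilation_kernel !lexx !subrr !N0.
  have -> : i <= i + t = (0 <= t) by rewrite lerDl.
  have -> : i + t <= i = (t <= 0) by rewrite gerDl.
  have e1 : i + t - i = t by ring.
  have e2 : i - (i + t) = - t by ring.
  rewrite e1 e2; case: (ltgtP t 0) => h.
  - rewrite (ltr0_norm h) -![Re (hinner _ _)]/(rip _ _) (ripC x); ring.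
  - rewrite (gtr0_norm h) -![Re (hinner _ _)]/(rip _ _) (ripC x (N _ _)); ring.
  - rewrite h oppr0 normr0 !N0 -![Re (hinner _ _)]/(rip _ _); ring.
have := hd _ (normr_ge0 t) td; rewrite ltr_pdivlMr // => h.
apply: le_lt_trans h; rewrite (hnB (N _ x)) mulrDr mulr1.
have := rip_le (x - N `|t| x) x; have := hn_ge0 (x - N `|t| x).
by move: (hnorm (x - _)) (hnorm x) (rip _ _) => a b c; lra.
Qed.
End UnitaryDilation.

(** * Nilpotent shift model *)

Section StepForm.
Variable R : realType.
Variable H : hilbertType R.
Implicit Types (l : seq (R * H)) (a c : R).

Definition step_form l : R := dsum (fun p r => Num.min p.1 r.1 * rip p.2 r.2) l.
Definition vsum l : H := \sum_(p <- l) p.2.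

(* [step_form l] is the squared norm in L^2(0, oo; H) of the step function
   [\sum_i 1_[0, c_i] x_i], and [step_tail a l] the part of it over [a, oo[ when all [c_i >= a]. *)
Definition step_tail a l := step_form l - a * rip (vsum l) (vsum l).

(** No jump lies in [a, c[, so the step function equals [vsum] of the whole list there and
    contributes the length times its squared norm. *)
Lemma step_tail_cons a c x l : (forall p, p \in l -> c <= p.1) ->
  step_tail a ((c, x) :: l) =
  (c - a) * rip (vsum ((c, x) :: l)) (vsum ((c, x) :: l)) + step_tail c l.
Proof.
move=> cl; rewrite /step_tail /step_form dsum_cons; last first.
  by move=> p r; rewrite minC ripC.
have -> : \sum_(r <- l) Num.min (c, x).1 r.1 * rip (c, x).2 r.2 = c * rip x (vsum l).
  rewrite rip_sumr mulr_sumr; apply: eq_big_seq => p /cl /= cp.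
  by rewrite min_l.
have -> : vsum ((c, x) :: l) = x + vsum l by rewrite /vsum big_cons.
rewrite /= minxx !ripDl !ripDr (ripC (vsum l) x).
by ring.
Qed.

Lemma step_tail_nil a : step_tail a [::] = 0.
Proof. by rewrite /step_tail /step_form /dsum /vsum !big_nil rip0l mulr0 subr0. Qed.

Section Contraction.
Variables (f : R -> R) (S : H -> H).
Hypotheses (fmono : forall c d, c <= d -> f c <= f d <= f c + (d - c))
  (Sl : clinear S) (Sc : forall x, hnorm (S x) <= hnorm x).

Definition lmap l := [seq (f p.1, S p.2) | p <- l].

(** Interval by interval: [f] does not lengthen the interval and [S] does not enlarge the value on
    it. The case of interest is the shift f(c) = c - t truncated to [0, b]. *)
Lemma step_tail_le a l : sorted (@fst_le R H) l -> (forall p, p \in l -> a <= p.1) ->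
  step_tail (f a) (lmap l) <= step_tail a l.
Proof.
elim: l a => [|[c x] l IH] a; first by rewrite !step_tail_nil.
move=> /sorted_consP /= [sl ml] al; have ac : a <= c := al (c, x) (mem_head _ _).
rewrite !step_tail_cons //; last by move=> _ /mapP [p pl ->] /=; have /andP[] := fmono (ml _ pl).
apply: lerD; last exact: IH.
have -> : vsum ((f c, S x) :: lmap l) = S (vsum ((c, x) :: l)).
  by rewrite /vsum (clin_sum Sl) !big_cons big_map.
have /andP[f1 f2] := fmono ac; rewrite -!hn_sqr.
apply: ler_pM; rewrite ?sqr_ge0 ?subr_ge0 //; first by lra.
by rewrite ler_pXn2r ?nnegrE ?hn_ge0.
Qed.

Lemma step_form_le l : f 0 = 0 -> (forall p, p \in l -> 0 <= p.1) ->
  step_form (lmap l) <= step_form l.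
Proof.
move=> f0; move: l; apply: sorted_wlog => [l l' ll' h l0|l sl l0].
  have l0' p : p \in l -> 0 <= p.1 by rewrite (perm_mem ll'); exact: l0.
  have := h l0'; by rewrite /step_form (dsum_perm _ ll') (dsum_perm _ (perm_map _ ll')).
by have := step_tail_le sl l0; rewrite /step_tail f0 !mul0r !subr0.
Qed.
End Contraction.

(** Compare with the image under f = 0 and S = 0, which satisfy the hypotheses of [step_tail_le] and
    produce the form 0. *)
Lemma step_tail_ge0 a l : sorted (@fst_le R H) l -> (forall p, p \in l -> a <= p.1) ->
  0 <= step_tail a l.
Proof.
move=> sl al.
have zl : clinear (fun _ : H => 0 : H) by move=> c x y; rewrite scaler0 addr0.
have zc (x : H) : hnorm (0 : H) <= hnorm x by rewrite hn0 hn_ge0.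
have fm (c d : R) : c <= d -> 0 <= (0 : R) <= 0 + (d - c) by move=> cd; rewrite lexx add0r subr_ge0.
apply: le_trans (step_tail_le fm zl zc sl al).
rewrite /step_tail /step_form /dsum mul0r subr0 big_map; apply: sumr_ge0 => p _.
by rewrite big_map; apply: sumr_ge0 => r _; rewrite /= rip0l mulr0.
Qed.

Lemma step_form_ge0 l : (forall p, p \in l -> 0 <= p.1) -> 0 <= step_form l.
Proof.
move: l; apply: sorted_wlog => [l l' ll' h l0|l sl l0].
  by rewrite /step_form -(dsum_perm _ ll'); apply: h => p; rewrite (perm_mem ll'); exact: l0.
by have := step_tail_ge0 sl l0; rewrite /step_tail mul0r subr0.
Qed.

(** Cauchy-Schwarz in the plane. It merges the estimates on two adjacent pieces of lengths s and r
    carrying the squared norms A and B. *)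
Lemma sqr_add_le (s r A B x y : R) : 0 <= s -> 0 <= r -> 0 <= A -> 0 <= B ->
  x ^+ 2 <= s * A -> y ^+ 2 <= r * B -> (x + y) ^+ 2 <= (s + r) * (A + B).
Proof.
move=> s0 r0 A0 B0 hx hy; suff : 2 * (x * y) <= s * B + r * A by rewrite sqrrD; lra.
have [xy|xy] := leP (x * y) 0; first by have := mulr_ge0 s0 B0; have := mulr_ge0 r0 A0; lra.
have [sB rA] : 0 <= s * B /\ 0 <= r * A by rewrite !mulr_ge0.
rewrite -(@ler_pXn2r _ 2) ?nnegrE //; [|lra|lra].
have h : x ^+ 2 * y ^+ 2 <= (s * A) * (r * B) by apply: ler_pM; rewrite ?sqr_ge0.
have := sqr_ge0 (s * B - r * A); rewrite !exprMn; lra.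
Qed.

Section Functional.
Variables (b L : R) (psi : R -> R).
Hypothesis psiL : forall c d, 0 <= c -> c <= d -> d <= b -> `|psi d - psi c| <= L * (d - c).
Hypothesis L0 : 0 <= L.

(** For psi(0) = 0 this is formally the integral of psi' against the step function, as 1_[0,c] x is
    sent to psi(c) x. The norm of psi' in L^2(0, b) is at most sqrt(b) L, which explains the bound
    below. *)
Definition psum l : H := \sum_(p <- l) ((psi p.1)%:C)%C *: p.2.

(* Abel summation: with [z] the value of the step function on an interval [a, c] free of
   jumps, that interval contributes [(psi c - psi a) z]. *)
Lemma psum_tail a l : sorted (@fst_le R H) l -> 0 <= a -> a <= b ->
  (forall p, p \in l -> a <= p.1 <= b) ->
  hnorm (psum l - ((psi a)%:C)%C *: vsum l) ^+ 2 <= (b - a) * (L ^+ 2 * step_tail a l).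
Proof.
elim: l a => [|[c x] l IH] a.
  move=> _ _ _ _; rewrite step_tail_nil /psum /vsum !big_nil scaler0 subrr hn0.
  by rewrite expr0n /= !mulr0.
move=> sl' a0 ab al; have /sorted_consP /= [sl ml] := sl'.
have /= /andP[ac cb] := al (c, x) (mem_head _ _).
have c0 : 0 <= c by apply: le_trans ac.
have al' p : p \in l -> c <= p.1 <= b.
  by move=> pl; rewrite ml //=; have /andP[] := al p (mem_behead (s := _ :: _) pl).
have {}IH := IH c sl c0 cb al'.
have tl0 : 0 <= step_tail c l by apply: step_tail_ge0.
rewrite step_tail_cons //; set z := vsum ((c, x) :: l).
have -> : psum ((c, x) :: l) - ((psi a)%:C)%C *: z =
  ((psi c - psi a)%:C)%C *: z + (psum l - ((psi c)%:C)%C *: vsum l).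
  have zE : z = x + vsum l by rewrite /z /vsum big_cons.
  have -> : psum ((c, x) :: l) = ((psi c)%:C)%C *: x + psum l by rewrite /psum big_cons.
  rewrite rmorphB scalerBl [in RHS]addrAC; congr (_ - _).
  by rewrite zE scalerDr [psum l - _]addrC addrA addrK.
have -> : b - a = (c - a) + (b - c) by ring.
rewrite mulrDr.
set u := psum l - _ in IH *.
apply: (@le_trans _ _ ((L * (c - a) * hnorm z + hnorm u) ^+ 2)).
  rewrite ler_pXn2r ?nnegrE ?addr_ge0 ?mulr_ge0 ?hn_ge0 ?subr_ge0 //.
  apply: le_trans (hnD _ _) _; rewrite lerD2r hnR; apply: ler_wpM2r; first exact: hn_ge0.
  exact: psiL.
apply: sqr_add_le => //; rewrite ?subr_ge0 ?mulr_ge0 ?sqr_ge0 ?subr_ge0 ?rip_ge0 //.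
  by rewrite -subr_ge0.
by rewrite -hn_sqr le_eqVlt; apply/orP; left; apply/eqP; ring.
Qed.

Lemma psum_le l : psi 0 = 0 -> 0 <= b -> (forall p, p \in l -> 0 <= p.1 <= b) ->
  hnorm (psum l) ^+ 2 <= b * L ^+ 2 * step_form l.
Proof.
move=> p0 b0; move: l; apply: sorted_wlog => [l l' ll' h l0|l sl l0].
  rewrite /step_form -(dsum_perm _ ll') /psum -(perm_big _ ll'); apply: h => p.
  by rewrite (perm_mem ll'); exact: l0.
have := psum_tail sl (lexx _) b0 l0.
by rewrite /step_tail p0 scale0r mul0r !subr0 mulrA.
Qed.
End Functional.
End StepForm.

Section NilpotentModel.
Variable R : realType.
Local Notation C := R[i].
Local Notation Re := complex.Re.
Variables (H : hilbertType R) (S : R -> H -> H) (b L : R) (psi : R -> R).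
Hypotheses (SC0 : C0_semigroup S)
  (Sc : forall t, 0 <= t -> forall x, hnorm (S t x) <= hnorm x).
Hypotheses (b0 : 0 < b) (L0 : 0 <= L) (psi0 : psi 0 = 0)
  (psiL : forall c d, 0 <= c -> c <= d -> d <= b -> `|psi d - psi c| <= L * (d - c)).

Let Sl t : 0 <= t -> clinear (S t).
Proof. by case: SC0 => h _ _ _ /h /bop_lin. Qed.

(** Clamping lets every real number index a vector of the model. Negative indices go to 0, where the
    vector vanishes, so the shift is defined for all indices and dies after time b. *)
Definition clip (c : R) := Num.max 0 (Num.min c b).

Lemma clip_ge0 c : 0 <= clip c. Proof. by rewrite le_max lexx. Qed.
Lemma clip_le c : clip c <= b. Proof. by rewrite ge_max ge_min lexx orbT (ltW b0). Qed.
Lemma clip_id c : 0 <= c -> c <= b -> clip c = c.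
Proof. by move=> c0 cb; rewrite /clip min_l // max_r. Qed.
Lemma clip_neg c : c <= 0 -> clip c = 0.
Proof. by move=> h; apply: max_l; rewrite ge_min h. Qed.
Lemma clip_mono c d : c <= d -> clip c <= clip d <= clip c + (d - c).
Proof.
rewrite /clip => cd; case: (leP c b) => h1; case: (leP d b) => h2; case: (leP 0 c) => h3;
  case: (leP 0 d) => h4; case: (leP 0 b) => h5; apply/andP; split; move: b0; lra.
Qed.
Lemma clip_sub c t s : 0 <= t -> 0 <= s -> clip (clip (clip c - s) - t) = clip (clip c - (t + s)).
Proof.
move=> t0 s0; have h1 := clip_ge0 c; have h2 := clip_le c.
have [h|h] := leP (clip c - s) 0.
  by rewrite (clip_neg h) (@clip_neg (0 - t)) ?(@clip_neg (clip c - (t + s))) //; lra.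
rewrite (@clip_id (clip c - s)); [by congr clip; ring|exact: ltW|lra].
Qed.

Definition step_kernel (c d : R) (x y : H) : C := ((Num.min (clip c) (clip d))%:C)%C * hinner x y.

Definition clipmap (l : seq (R * H)) := [seq (clip p.1, p.2) | p <- l].

Lemma nilpotent_model : exists (K : hilbertType R) (B : H -> K) (A : K -> H) (N : R -> K -> K),
  [/\ bounded_op B, bounded_op A, contractive_nilpotent_C0_semigroup N &
      forall t, 0 <= t -> t <= b -> forall x, A (N t (B x)) = ((psi (b - t))%:C)%C *: S t x].
Proof.
have hH := hinner_semi H.
have formE (l : seq (R * H)) : \sum_(p <- l) \sum_(r <- l) Re (step_kernel p.1 r.1 p.2 r.2) =
    step_form (clipmap l).
  rewrite /step_form /dsum big_map; apply: eq_bigr => p _; rewrite big_map.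
  by apply: eq_bigr => r _; rewrite /step_kernel cReM cImR cReR mul0r subr0.
have clip0 (l : seq (R * H)) p : p \in clipmap l -> 0 <= p.1 <= b.
  by move=> /mapP [r _ ->] /=; rewrite clip_ge0 clip_le.
have clip00 (l : seq (R * H)) p : p \in clipmap l -> 0 <= p.1.
  by move=> /clip0 /andP[].
have [K [Phi [Pl tot Pip]]] : exists (K : hilbertType R) (Phi : R -> H -> K),
    [/\ (forall s, clinear (Phi s)), total_family Phi &
        (forall s t x y, hinner (Phi s x) (Phi t y) = step_kernel s t x y)].
  apply: kernel_dilation.
  - by move=> s t a x y z; rewrite /step_kernel (sinDl hH) (sinZl hH); ring.
  - move=> s t x y; rewrite /step_kernel rmorphM /= -(sinC hH) minC; congr (_ * _).
    by apply: complex_ext; rewrite /= ?oppr0.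
  - by move=> l; rewrite formE; apply: step_form_ge0; exact: clip00.
have Prip s t x y : rip (Phi s x) (Phi t y) = Num.min (clip s) (clip t) * rip x y.
  by rewrite /rip Pip /step_kernel cReM cImR cReR mul0r subr0.
have Pn s x : hnorm (Phi s x) ^+ 2 = clip s * hnorm x ^+ 2 by rewrite !hn_sqr Prip minxx.
have lsumE l : hnorm (lsum Phi l) ^+ 2 = step_form (clipmap l).
  rewrite hnorm_lsum /step_form /dsum big_map; apply: eq_bigr => p _; rewrite big_map.
  by apply: eq_bigr => r _; rewrite Prip.
have Pclip c d x : clip c = clip d -> Phi c x = Phi d x.
  move=> cd; apply/eqP; rewrite -subr_eq0; apply/eqP/rip_eq0.
  by rewrite !ripBl !ripBr !Prip cd; ring.
(* Left shift by t combined with S(t): 1_[0,c] x becomes 1_[0,c-t] S(t) x. Negative times receive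
   the identity as a dummy value. *)
have /choice [N hN] : forall t : R, exists F : K -> K, 0 <= t ->
    [/\ bounded_op F, (forall c x, F (Phi c x) = Phi (clip c - t) (S t x)) &
        (forall k, hnorm (F k) <= 1 * hnorm k)].
  move=> t; have [t0|t0] := leP 0 t; last by exists id.
  suff [F hF] : exists F : K -> K,
    [/\ bounded_op F, (forall c x, F (Phi c x) = Phi (clip c - t) (S t x)) &
        (forall k, hnorm (F k) <= 1 * hnorm k)] by exists F.
  apply: (@total_extension _ _ _ _ _ Phi (fun c x => Phi (clip c - t) (S t x))) => //.
    by move=> c a x y; rewrite (Sl t0) Pl.
  move=> l; rewrite mul1r -(@ler_pXn2r _ 2) ?nnegrE ?hn_ge0 // lsumE.
  have -> : lsum (fun c x => Phi (clip c - t) (S t x)) l =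
      lsum Phi [seq (clip p.1 - t, S t p.2) | p <- l] by rewrite /lsum big_map.
  rewrite lsumE.
  have -> : clipmap [seq (clip p.1 - t, S t p.2) | p <- l] =
      lmap (fun c => clip (c - t)) (S t) (clipmap l) by rewrite /clipmap /lmap -!map_comp.
  apply: step_form_le => //; [|exact: Sl|exact: Sc|by rewrite clip_neg //; lra|exact: clip00].
  move=> c d cd; have -> : d - c = (d - t) - (c - t) by ring.
  by apply: clip_mono; rewrite lerD2r.
have Nb t : 0 <= t -> bounded_op (N t) by move=> /hN [].
have NP t c x : 0 <= t -> N t (Phi c x) = Phi (clip c - t) (S t x) by move=> /hN [].
have Nc t k : 0 <= t -> hnorm (N t k) <= hnorm k by move=> /hN [_ _ /(_ k)]; rewrite mul1r.
have [_ S0 SD Scont] := SC0.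
have NC0 : C0_semigroup N.
  split => //.
  - apply: (total_eq tot (Nb 0 (lexx 0)) (bop_id K)) => c x.
    rewrite NP // S0 subr0; apply: Pclip.
    by rewrite clip_id ?clip_ge0 ?clip_le.
  - move=> t s k t0 s0; apply: (total_eq tot (Nb _ _) (bop_comp (Nb s s0) (Nb t t0))).
      exact: addr_ge0.
    move=> c x; rewrite !NP ?addr_ge0 // -SD //; apply: Pclip.
    by rewrite clip_sub.
  - move=> k eps e0.
    suff [d d0 hd] : exists2 delta : R, 0 < delta &
        forall t, 0 <= t -> `|t| < delta -> hnorm (N t k - k) < eps.
      by exists d => // t t0 td; apply: hd => //; rewrite ger0_norm.
    apply: (total_continuity tot) e0 => //; first by move=> t /Nb /bop_lin.
    move=> c x {}eps e0.
    (* Two errors: S(t) x - x on an interval of length at most b, costing a factor sqrt(b), and the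
       lost piece of length at most t, of squared norm at most t |x|^2. *)
    pose q := Num.sqrt b; have q0 : 0 < q by rewrite sqrtr_gt0.
    have e2 : 0 < eps / 2 by rewrite divr_gt0.
    have [d1 d10 h1] := Scont x _ (divr_gt0 e2 q0).
    have x1 : 0 < hnorm x ^+ 2 + 1 by rewrite ltr_wpDl ?sqr_ge0.
    exists (Num.min d1 ((eps / 2) ^+ 2 / (hnorm x ^+ 2 + 1))).
      by rewrite lt_min d10 divr_gt0 ?exprn_gt0.
    move=> t t0; rewrite ger0_norm // lt_min => /andP[/(h1 t t0) {}h1].
    rewrite ltr_pdivlMr // => h2; rewrite NP //.
    apply: le_lt_trans (hn_triangle (Phi (clip c - t) x) _ _) _.
    rewrite (splitr eps); apply: ltrD.
      rewrite -(clinB (Pl _)); move: h1; rewrite ltr_pdivlMr // => h1.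
      apply: le_lt_trans h1; rewrite -(@ler_pXn2r _ 2) ?nnegrE ?mulr_ge0 ?hn_ge0 ?(ltW q0) //.
      rewrite Pn exprMn /q (@sqr_sqrtr _ b); last exact: (ltW b0).
      rewrite [leRHS]mulrC.
      by apply: ler_wpM2r; [exact: sqr_ge0|exact: clip_le].
    rewrite -(@ltr_pXn2r _ 2) ?nnegrE ?hn_ge0 ?(ltW e2) //.
    apply: le_lt_trans h2; rewrite (hn_sqr (_ - _)) !ripBl !ripBr !Prip !minxx -hn_sqr.
    have cc : clip (clip c) = clip c by rewrite clip_id ?clip_ge0 ?clip_le.
    have ct : clip c - t <= clip c by lra.
    have := clip_mono ct; rewrite cc => /andP[m1 m2].
    rewrite (minC (clip c)) (min_l m1) mulrDr mulr1.
    have := sqr_ge0 (hnorm x); move: (hnorm x ^+ 2) => X X0.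
    have : (clip c - clip (clip c - t)) * X <= t * X by apply: ler_wpM2r => //; lra.
    by lra.
have [A [Ab AP _]] : exists F : K -> H,
    [/\ bounded_op F, (forall c x, F (Phi c x) = ((psi (clip c))%:C)%C *: x) &
        (forall k, hnorm (F k) <= (Num.sqrt b * L) * hnorm k)].
  apply: (@total_extension _ _ _ _ _ Phi (fun c x => ((psi (clip c))%:C)%C *: x)) => //.
  - by rewrite mulr_ge0 ?sqrtr_ge0.
  - by move=> c a x y; rewrite scalerDr !scalerA mulrC.
  - move=> l; rewrite -(@ler_pXn2r _ 2) ?nnegrE ?mulr_ge0 ?hn_ge0 ?sqrtr_ge0 //.
    rewrite !exprMn (@sqr_sqrtr _ b) ?(ltW b0) // lsumE.
    have := psum_le psiL L0 psi0 (ltW b0) (@clip0 l).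
    by rewrite /psum big_map.
have Bb : bounded_op (Phi b).
  split; first exact: Pl.
  exists (Num.sqrt b) => x; rewrite -(@ler_pXn2r _ 2) ?nnegrE ?mulr_ge0 ?hn_ge0 ?sqrtr_ge0 //.
  by rewrite Pn exprMn (@sqr_sqrtr _ b) ?(ltW b0) // clip_id // ltW.
have cb : clip b = b by rewrite clip_id // ltW.
exists K, (Phi b), A, N; split => //.
  split => //; first by move=> t t0 k; exact: Nc.
  exists b => // k; have zb : bounded_op (fun _ : K => 0 : K).
    split; first by move=> a x y; rewrite scaler0 addr0.
    by exists 0 => x; rewrite hn0 mul0r.
  apply: (total_eq tot (Nb b (ltW b0)) zb) => c x; rewrite NP ?(ltW b0) //.
  apply: rip_eq0; rewrite Prip clip_neg ?minxx ?mul0r //.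
  by rewrite subr_le0 clip_le.
move=> t t0 tb x; rewrite NP // AP cb clip_id ?subr_ge0 //; lra.
Qed.
End NilpotentModel.

(** * A Lipschitz weight undoing the exponential rescaling *)

Section Bump.
Variables (R : realType) (lambda b : R).
Hypotheses (lambda0 : 0 <= lambda) (b1 : 1 <= b).

Lemma expR_lipschitz c d : 0 <= c -> c <= d -> d <= b ->
  0 <= expR (lambda * (b - c)) - expR (lambda * (b - d)) <= lambda * expR (lambda * b) * (d - c).
Proof.
move=> c0 cd db.
have h0 : lambda * (b - d) <= lambda * (b - c) by apply: ler_wpM2l => //; lra.
rewrite subr_ge0 ler_expR h0 /=.
have -> : lambda * (b - d) = lambda * (b - c) + - (lambda * (d - c)) by ring.
rewrite expRD -{1}(mulr1 (expR (lambda * (b - c)))) -mulrBr.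
have h1 : expR (lambda * (b - c)) <= expR (lambda * b).
  by rewrite ler_expR; apply: ler_wpM2l => //; lra.
have h2 : 1 - expR (- (lambda * (d - c))) <= lambda * (d - c).
  by have := expR_ge1Dx (- (lambda * (d - c))); lra.
have h3 : 0 <= 1 - expR (- (lambda * (d - c))).
  by rewrite subr_ge0 -expR0 ler_expR oppr_le0 mulr_ge0 // subr_ge0.
rewrite (mulrC lambda (expR (lambda * b))) -mulrA; apply: ler_pM => //; exact: expR_ge0.
Qed.

(** The linear branch makes the weight vanish at 0. Its slope is at least exp(lambda b), so that the
    exponential branch is the minimum for c >= 1, and at least lambda exp(lambda b), so that it is a
    Lipschitz constant for both branches. *)
Definition bump (c : R) :=
  Num.min (expR (lambda * (b - c))) ((1 + lambda) * expR (lambda * b) * c).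

Lemma bump0 : bump 0 = 0.
Proof. by rewrite /bump mulr0 min_r // expR_ge0. Qed.

Lemma bumpE c : 1 <= c -> bump c = expR (lambda * (b - c)).
Proof.
move=> c1; rewrite /bump min_l //.
apply: (@le_trans _ _ (expR (lambda * b))).
  by rewrite ler_expR; apply: ler_wpM2l => //; lra.
have e0 := expR_ge0 (lambda * b).
by rewrite mulrAC ler_peMl // mulr_ege1 // lerDl.
Qed.

Lemma bump_lipschitz c d : 0 <= c -> c <= d -> d <= b ->
  `|bump d - bump c| <= (1 + lambda) * expR (lambda * b) * (d - c).
Proof.
move=> c0 cd db; have /andP[h1 h2] := expR_lipschitz c0 cd db.
have e0 := expR_ge0 (lambda * b); rewrite /bump.
have h3 : 0 <= expR (lambda * b) * (d - c) by rewrite mulr_ge0 // subr_ge0.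
have h4 : 0 <= lambda * (expR (lambda * b) * (d - c)) by rewrite mulr_ge0.
move: (expR (lambda * (b - c))) (expR (lambda * (b - d))) (expR (lambda * b)) h1 h2 h3 h4 => u v w h1 h2 h3 h4.
rewrite ler_norml; case: (leP v _) => k1; case: (leP u _) => k2; apply/andP; split; lra.
Qed.
End Bump.

(** * From similarity to a quasi-contraction to the nilpotent model *)

Section QuasiToNilpotent.
Variables (R : realType) (H : hilbertType R).

Definition rescaled (V W : H -> H) (lambda : R) (T : R -> H -> H) (t : R) (x : H) : H :=
  ((expR (- (lambda * t)))%:C)%C *: V (T t (W x)).

Variables (T : R -> H -> H) (V W : H -> H) (lambda : R).
Hypotheses (TC0 : C0_semigroup T) (Vb : bounded_op V) (Wb : bounded_op W)
  (VW : forall x, V (W x) = x) (WV : forall x, W (V x) = x) (lambda0 : 0 <= lambda).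

Lemma rescaled_C0 : C0_semigroup (rescaled V W lambda T).
Proof.
have [Tb T0 TD Tc] := TC0; rewrite /rescaled; split.
- by move=> t t0; apply/bop_scale; exact: bop_comp (bop_comp Wb (Tb t t0)) Vb.
- by move=> x; rewrite mulr0 oppr0 expR0 T0 VW scale1r.
- move=> t s x t0 s0; have Tl := bop_lin (Tb t t0).
  rewrite (clinZ (bop_lin Wb)) WV (clinZ Tl) (clinZ (bop_lin Vb)) scalerA TD //.
  by rewrite mulrDr opprD expRD rmorphM.
- move=> x eps e0; have [M M0 hM] := bop_bound Vb.
  have e2 : 0 < eps / 2 by rewrite divr_gt0.
  have [d1 d10 h1] := Tc (W x) _ (divr_gt0 e2 M0).
  have x1 : 0 < lambda * hnorm x + 1 by rewrite ltr_wpDl ?mulr_ge0 ?hn_ge0.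
  exists (Num.min d1 (eps / 2 / (lambda * hnorm x + 1))); first by rewrite lt_min d10 divr_gt0.
  move=> t t0; rewrite lt_min => /andP[/(h1 t t0)]; rewrite ltr_pdivlMr // => {}h1.
  rewrite ltr_pdivlMr // => h2.
  set e := expR _; have e_ge0 : 0 <= e by exact: expR_ge0.
  have e_le1 : e <= 1 by rewrite /e -expR0 ler_expR oppr_le0 mulr_ge0.
  have e_near : 1 - e <= lambda * t by have := expR_ge1Dx (- (lambda * t)); rewrite -/e; lra.
  apply: le_lt_trans (hn_triangle ((e%:C)%C *: x) _ _) _.
  rewrite (splitr eps); apply: ltrD.
    rewrite -scalerBr hnR ger0_norm // -{2}(VW x) -(clinB (bop_lin Vb)).
    apply: le_lt_trans h1; apply: le_trans (ler_piMl (hn_ge0 _) e_le1) _.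
    by rewrite [leRHS]mulrC; exact: hM.
  have -> : (e%:C)%C *: x - x = ((e - 1)%:C)%C *: x by rewrite rmorphB scalerBl scale1r.
  rewrite hnR ler0_norm; last by lra.
  apply: le_lt_trans h2; rewrite mulrDr mulr1 mulrA opprB.
  apply: (@le_trans _ _ (lambda * t * hnorm x)); first by apply: ler_wpM2r; rewrite ?hn_ge0.
  by rewrite (mulrC t lambda) lerDl.
Qed.

Lemma rescaled_contraction (lambda' : R) : lambda' <= lambda ->
  (forall t, 0 <= t -> forall x, hnorm (V (T t (W x))) <= expR (lambda' * t) * hnorm x) ->
  forall t, 0 <= t -> forall x, hnorm (rescaled V W lambda T t x) <= hnorm x.
Proof.
move=> ll h t t0 x; rewrite /rescaled hnR ger0_norm ?expR_ge0 //.
apply: le_trans (ler_wpM2l (expR_ge0 _) (h t t0 x)) _.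
rewrite mulrA -expRD; apply: ler_piMl (hn_ge0 _) _.
rewrite -expR0 ler_expR; have := ler_wpM2r t0 ll; lra.
Qed.

Lemma rescaledK t x : 0 <= t ->
  T t x = W (((expR (lambda * t))%:C)%C *: rescaled V W lambda T t (V x)).
Proof.
by move=> t0; rewrite /rescaled scalerA -rmorphM -expRD subrr expR0 scale1r !WV.
Qed.
End QuasiToNilpotent.

Lemma quasi_contraction_nilpotent (R : realType) (H : hilbertType R) (T : R -> H -> H) :
  C0_semigroup T -> similar_to_quasi_contraction T -> forall nu : R, 0 < nu ->
  exists (K : hilbertType R) (B : H -> K) (A : K -> H) (N : R -> K -> K),
    [/\ bounded_op B, bounded_op A, contractive_nilpotent_C0_semigroup N &
        forall t, 0 <= t -> t <= nu -> forall x, T t x = A (N t (B x))].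
Proof.
move=> TC0 [V [W [Vi VW WV [lam hlam]]]] nu nu0.
have Vb := Vi.1; have Wb := inverse_bounded Vi WV.
have l0 := normr_ge0 lam.
(* With b = nu + 1 the weight is read at b - t >= 1 for all t <= nu, where it is exactly exp(lambda
   t). *)
have b1 : 1 <= nu + 1 by lra.
have L0 : 0 <= (1 + `|lam|) * expR (`|lam| * (nu + 1)) by rewrite mulr_ge0 ?expR_ge0 ?addr_ge0.
have b0 : 0 < nu + 1 by lra.
have [K [B [A [N [Bb Ab Nn hN]]]]] := nilpotent_model (rescaled_C0 TC0 Vb Wb VW WV l0)
  (rescaled_contraction (ler_norm lam) hlam) b0 L0 (bump0 `|lam| _) (@bump_lipschitz _ `|lam| _ l0).
exists K, (fun x => B (V x)), (fun k => W (A k)), N; split => //.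
- exact: bop_comp Vb Bb.
- exact: bop_comp Ab Wb.
- move=> t t0 tn x; rewrite hN //; last by lra.
  rewrite bumpE //; last by lra.
  rewrite (rescaledK T `|lam| WV x t0); congr (W (_ *: _)); congr ((expR _)%:C)%C; ring.
Qed.

(** * Square root of a positive form *)

Section SquareRoot.
Variable R : realType.
Local Notation C := R[i].
Variable H : hilbertType R.
Implicit Types (x y : H) (u : nat -> H).

Lemma geometric_cvg u (M q : R) : 0 <= M -> 0 <= q -> q < 1 ->
  (forall n, hnorm (u n.+1 - u n) <= M * q ^+ n) -> exists l, hcvg u l.
Proof.
move=> M0 q0 q1 h; have q10 : 0 < 1 - q by lra.
have tail n k : hnorm (u (n + k)%N - u n) <= M / (1 - q) * (q ^+ n - q ^+ (n + k)).
  elim: k => [|k IH]; first by rewrite addn0 !subrr hn0 mulr0.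
  rewrite addnS; apply: le_trans (hn_triangle (u (n + k)%N) _ _) _.
  apply: le_trans (lerD (h _) IH) _; rewrite exprS le_eqVlt; apply/orP; left; apply/eqP.
  by field; lra.
apply: hcauchy_cvg => eps e0.
have hq : (fun n => M / (1 - q) * q ^+ n) @ \oo --> (0 : R).
  by apply: seq_cvgM0; apply: cvg_expr; rewrite ger0_norm.
have /seq_cvgP /(_ _ (divr_gt0 e0 (ltr0n _ 2))) [N hN] := hq.
have c0 : 0 <= M / (1 - q) by rewrite divr_ge0 // ltW.
have close n : (N <= n)%N -> hnorm (u n - u N) < eps / 2.
  move=> /subnKC <-; apply: le_lt_trans (tail _ _) _.
  have := hN N (leqnn N); rewrite subr0 ger0_norm ?(mulr_ge0 c0 (exprn_ge0 _ q0)) //.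
  by apply: le_lt_trans; apply: ler_wpM2l => //; rewrite lerBlDr lerDl exprn_ge0.
exists N => m n /close h1 /close h2; apply: le_lt_trans (hn_triangle (u N) _ _) _.
by rewrite (hnB (u N)); lra.
Qed.

Lemma neumann_inverse (Y : H -> H) (q : R) : clinear Y -> 0 <= q -> q < 1 ->
  (forall x, hnorm (Y x) <= q * hnorm x) -> forall y, exists x, x - Y x = y.
Proof.
move=> Yl q0 q1 Yb y.
pose u := fix u (n : nat) : H := if n is m.+1 then y + Y (u m) else 0.
have [l hl] : exists l, hcvg u l.
  apply: (@geometric_cvg u (hnorm y) q (hn_ge0 _) q0 q1); elim=> [|n IH].
    by rewrite /= (clin0 Yl) addr0 subr0 expr0 mulr1.
  have -> : u n.+2 - u n.+1 = Y (u n.+1 - u n).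
    by rewrite (clinB Yl) /= opprD addrACA subrr add0r.
  by apply: le_trans (Yb _) _; rewrite exprS mulrCA; apply: ler_wpM2l.
have Ybo : bounded_op Y by split => //; exists q.
exists l; apply/eqP; rewrite subr_eq; apply/eqP.
have h1 : hcvg (fun n => u n.+1) l by rewrite /hcvg -(cvg_shiftS (fun n => hnorm (u n - l))) in hl *.
by apply: hcvg_uniq h1 (hcvgD (hcvg_cst y) (hcvg_op Ybo hl)).
Qed.

(* The fixed point of [Y = (D + Y^2) / 2], so that [(1 - Y)^2 = 1 - D]. *)
Lemma sqrt_fixpoint (D : H -> H) (q : R) : clinear D -> 0 <= q -> q < 1 ->
  (forall x y, rip (D x) y = rip x (D y)) -> (forall x, hnorm (D x) <= q * hnorm x) ->
  exists Y : H -> H, [/\ clinear Y, (forall x y, rip (Y x) y = rip x (Y y)),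
    (forall x, hnorm (Y x) <= q * hnorm x) & (forall x, Y x + Y x = D x + Y (Y x))].
Proof.
move=> Dl q0 q1 Ds Db.
pose Yn := fix Yn (n : nat) (x : H) : H :=
  if n is m.+1 then ((2^-1)%:C)%C *: (D x + Yn m (Yn m x)) else 0.
have Yl n : clinear (Yn n).
  elim: n => [|n IH] a x y /=; first by rewrite scaler0 addr0.
  rewrite Dl !IH addrACA -scalerDr [LHS]scalerDr; congr (_ + _).
  by rewrite !scalerA mulrC.
have Ys n x y : rip (Yn n x) y = rip x (Yn n y).
  elim: n x y => [|n IH] x y /=; first by rewrite rip0l rip0r.
  by rewrite ripRl ripRr ripDl ripDr Ds !IH.
have Yb n x : hnorm (Yn n x) <= q * hnorm x.
  elim: n x => [|n IH] x /=; first by rewrite hn0 mulr_ge0 ?hn_ge0.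
  rewrite hnR ger0_norm ?invr_ge0 //.
  have h : hnorm (Yn n (Yn n x)) <= q * hnorm x.
    apply: le_trans (IH _) _; apply: ler_wpM2l => //; apply: le_trans (IH _) _.
    by rewrite ler_piMl ?hn_ge0 // ltW.
  by have := hnD (D x) (Yn n (Yn n x)); have := Db x; lra.
(* Y_(n+1)^2 - Y_n^2 = Y_(n+1) (Y_(n+1) - Y_n) + (Y_(n+1) - Y_n) Y_n, a splitting that needs no
   commutation. Each outer factor contributes q and the half averages the two terms, so increments
   shrink by q. *)
have step n x : hnorm (Yn n.+1 x - Yn n x) <= (q * hnorm x) * q ^+ n.
  elim: n x => [|n IH] x.
    rewrite [Yn 0 x]/= subr0 expr0 mulr1; exact: Yb.
  have -> : Yn n.+2 x - Yn n.+1 x = ((2^-1)%:C)%C *: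
      (Yn n.+1 (Yn n.+1 x - Yn n x) + (Yn n.+1 (Yn n x) - Yn n (Yn n x))).
    rewrite (clinB (Yl n.+1)) addrA subrK -[Yn n.+2 x]/(_ *: (D x + Yn n.+1 (Yn n.+1 x))).
    by rewrite -[X in _ - X]/(_ *: (D x + Yn n (Yn n x))) -scalerBr opprD addrACA subrr add0r.
  rewrite hnR ger0_norm ?invr_ge0 //.
  have h1 := le_trans (Yb n.+1 _) (ler_wpM2l q0 (IH x)).
  have h2 := le_trans (IH (Yn n x)) (ler_wpM2r (exprn_ge0 n q0) (ler_wpM2l q0 (Yb n x))).
  have h3 := hnD (Yn n.+1 (Yn n.+1 x - Yn n x)) (Yn n.+1 (Yn n x) - Yn n (Yn n x)).
  have -> : q * hnorm x * q ^+ n.+1 = q * (q * hnorm x * q ^+ n) by rewrite exprS; ring.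
  have e : q * (q * hnorm x) * q ^+ n = q * (q * hnorm x * q ^+ n) by ring.
  by rewrite e in h2; lra.
have /choice [Y hY] : forall x, exists l, hcvg (Yn ^~ x) l.
  by move=> x; apply: (@geometric_cvg _ (q * hnorm x) q) => //; rewrite mulr_ge0 ?hn_ge0.
have Ynn x : hcvg (fun n => Yn n (Yn n x)) (Y (Y x)).
  apply: hcvg_le (seq_cvgD0 (seq_cvgM0 q (hY x)) (hY (Y x))) => n.
  apply: le_trans (hn_triangle (Yn n (Y x)) _ _) _; rewrite lerD2r -(clinB (Yl n)).
  exact: Yb.
exists Y; split.
- move=> a x y; apply: hcvg_uniq (hY _) _.
  by apply: hcvg_ext (hcvgD (hcvgZ a (hY x)) (hY y)) => n; rewrite Yl.
- move=> x y; apply: (seq_cvg_uniq (hcvg_rip (hY x) (hcvg_cst y))).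
  by apply: seq_cvg_ext (hcvg_rip (hcvg_cst x) (hY y)) => n; rewrite Ys.
- by move=> x; apply: (seq_cvg_lec (hcvg_norm (hY x))).
- move=> x; have h1 : hcvg (fun n => Yn n.+1 x) (Y x).
    by have := hY x; rewrite /hcvg -(cvg_shiftS (fun n => hnorm (Yn n x - Y x))).
  apply: hcvg_uniq (hcvgD h1 h1) _.
  apply: hcvg_ext (hcvgD (hcvg_cst (D x)) (Ynn x)) => n.
  rewrite -[Yn n.+1 x]/(_ *: (D x + Yn n (Yn n x))) -scalerDl -rmorphD.
  by rewrite (_ : 2^-1 + 2^-1 = 1 :> R) ?scale1r //; field.
Qed.

Lemma inverse_exists (V : H -> H) (m : R) : bounded_op V -> 0 < m ->
  (forall x, m * hnorm x <= hnorm (V x)) -> (forall y, exists x, V x = y) ->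
  exists W : H -> H, [/\ invertible_op V, (forall x, V (W x) = x) & (forall x, W (V x) = x)].
Proof.
move=> Vb m0 Vm /choice [W VW]; have Vl := bop_lin Vb.
have Vinj x y : V x = V y -> x = y.
  move=> e; apply/eqP; rewrite -subr_eq0; apply/eqP/hn_eq0/le_anti; rewrite hn_ge0 andbT.
  by rewrite -(pmulr_rle0 _ m0); apply: le_trans (Vm _) _; rewrite (clinB Vl) e subrr hn0.
have WV x : W (V x) = x by apply: Vinj; rewrite VW.
have Wb : bounded_op W.
  split; first by move=> a x y; apply: Vinj; rewrite Vl !VW.
  exists m^-1 => x; rewrite -(@ler_pM2l _ m) // mulrA divff ?lt0r_neq0 // mul1r.
  by apply: le_trans (Vm _) _; rewrite VW.
by exists W; split => //; split => //; exists W.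
Qed.

Variable g : H -> H -> R.
Hypotheses (gD : forall x y z, g (x + y) z = g x z + g y z) (gC : forall x y, g x y = g y x)
  (gZ : forall a x y, g (a *: x) y = g x (conjc a *: y)).
Variables (c c' : R).
Hypotheses (c0 : 0 < c) (cc : c <= c') (glb : forall x, c * hnorm x ^+ 2 <= g x x)
  (gub : forall x, g x x <= c' * hnorm x ^+ 2).

Let gDr x y z : g z (x + y) = g z x + g z y. Proof. by rewrite gC gD !(gC z). Qed.
(** With G the Gram operator of [g], normalising by c' makes D = 1 - G / c' satisfy 0 <= D <= q = 1
    - c / c' < 1. Then V = sqrt(c') (1 - Y) with (1 - Y)^2 = 1 - D has V^2 = G, and |Y| <= q makes V
    surjective by a Neumann series. *)
Lemma form_sqrt : (forall (r : R) x y, g ((r%:C)%C *: x) y = r * g x y) ->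
  exists V W : H -> H, [/\ invertible_op V, (forall x, V (W x) = x), (forall x, W (V x) = x) &
    (forall x, hnorm (V x) ^+ 2 = g x x)].
Proof.
move=> gR.
have gRr (r : R) x y : g x ((r%:C)%C *: y) = r * g x y by rewrite gC gR gC.
have c'0 : 0 < c' by apply: lt_le_trans cc.
have g0 x : 0 <= g x x by apply: le_trans (glb x); rewrite mulr_ge0 ?sqr_ge0 // ltW.
have gcs x y : g x y ^+ 2 <= g x x * g y y.
  apply: discriminant_le => // t; have := g0 (x + (t%:C)%C *: y).
  rewrite gD !gDr !gR !gRr (gC y x); congr (_ <= _); ring.
have gb x y : `|g x y| <= (c' * hnorm x) * hnorm y.
  rewrite -(@ler_pXn2r _ 2) ?nnegrE ?mulr_ge0 ?hn_ge0 ?(ltW c'0) // real_normK ?num_real //.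
  apply: le_trans (gcs x y) _.
  have -> : (c' * hnorm x * hnorm y) ^+ 2 = (c' * hnorm x ^+ 2) * (c' * hnorm y ^+ 2) by ring.
  exact: ler_pM.
have /choice [G hG] : forall x, exists h, forall y, g x y = rip h y.
  move=> x; apply: (@riesz _ _ _ (c' * hnorm x)) => //.
pose D x := x - ((c'^-1)%:C)%C *: G x.
have Drip x y : rip (D x) y = rip x y - c'^-1 * g x y by rewrite /D ripBl ripRl -hG.
have Dl : clinear D.
  move=> a x y; apply: rip_sep => z; rewrite Drip ripDl [RHS]ripDl !Drip.
  by rewrite ripZ gD gZ [in RHS]ripZ Drip; ring.
clearbody D; pose q := 1 - c / c'.
have q0 : 0 <= q by rewrite subr_ge0 ler_pdivrMr // mul1r.
have q1 : q < 1 by rewrite ltrBlDr ltrDl divr_gt0.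
have Ds x y : rip (D x) y = rip x (D y) by rewrite (ripC x) !Drip ripC gC.
have D0 x : 0 <= rip (D x) x.
  by rewrite Drip subr_ge0 mulrC ler_pdivrMr // mulrC -hn_sqr.
have Dq x : rip (D x) x <= q * hnorm x ^+ 2.
  rewrite Drip -hn_sqr /q mulrBl mul1r lerD2l lerN2 mulrAC [leRHS]mulrC.
  by apply: ler_wpM2r; rewrite ?invr_ge0 // ltW.
have Db x : hnorm (D x) <= q * hnorm x.
  (* Cauchy-Schwarz for the positive form <D x, y>, applied to x and D x, turns the bound on the
     quadratic form into one on the operator norm. *)
  have cs : rip (D x) (D x) ^+ 2 <= rip (D x) x * rip (D (D x)) (D x).
    apply: discriminant_le => // t; have := D0 (x + (t%:C)%C *: D x).
    rewrite (clinD Dl) (clinZ Dl) !ripDl !ripDr !ripRl !ripRr (Ds (D x) x).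
    congr (_ <= _); ring.
  have [e|n0] := eqVneq (hnorm (D x)) 0; first by rewrite e mulr_ge0 ?hn_ge0.
  have p0 : 0 < hnorm (D x) by rewrite lt_def n0 hn_ge0.
  rewrite -(@ler_pXn2r _ 2) ?nnegrE ?mulr_ge0 ?hn_ge0 // -(@ler_pM2r _ (hnorm (D x) ^+ 2)) ?exprn_gt0 //.
  rewrite -expr2 (hn_sqr (D x)); apply: le_trans cs _.
  have -> : (q * hnorm x) ^+ 2 * rip (D x) (D x) = (q * hnorm x ^+ 2) * (q * hnorm (D x) ^+ 2).
    by rewrite (hn_sqr (D x)); ring.
  by apply: ler_pM.
have [Y [Yl Ys Yb YY]] := sqrt_fixpoint Dl q0 q1 Ds Db.
pose w := Num.sqrt c'; have w0 : 0 < w by rewrite sqrtr_gt0.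
pose V x := (w%:C)%C *: (x - Y x).
have Vn x : hnorm (V x) ^+ 2 = g x x.
  rewrite /V hnR exprMn real_normK ?num_real // sqr_sqrtr ?(ltW c'0) // hn_sqr.
  have e : rip (D x) x + rip (Y x) (Y x) = 2 * rip (Y x) x.
    by have := congr1 (fun k => rip k x) (YY x); rewrite /= !ripDl (Ys (Y x) x); lra.
  have -> : rip (x - Y x) (x - Y x) = rip x x - rip (D x) x.
    by rewrite !ripBl !ripBr (ripC x (Y x)); lra.
  by rewrite Drip opprB addrC subrK mulrA divff ?mul1r // lt0r_neq0.
have Vb : bounded_op V.
  split; first by move=> a x y; rewrite /V Yl opprD addrACA -scalerBr scalerDr !scalerA mulrC.
  exists w => x; rewrite -(@ler_pXn2r _ 2) ?nnegrE ?mulr_ge0 ?hn_ge0 ?(ltW w0) //.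
  by rewrite Vn exprMn sqr_sqrtr // ltW.
have Vm x : Num.sqrt c * hnorm x <= hnorm (V x).
  rewrite -(@ler_pXn2r _ 2) ?nnegrE ?mulr_ge0 ?hn_ge0 ?sqrtr_ge0 //.
  by rewrite Vn exprMn sqr_sqrtr // ltW.
have Vs y : exists x, V x = y.
  have [x hx] := neumann_inverse Yl q0 q1 Yb (((w^-1)%:C)%C *: y); exists x.
  by rewrite /V hx scalerA -rmorphM divff ?lt0r_neq0 // scale1r.
have sc0 : 0 < Num.sqrt c by rewrite sqrtr_gt0.
have [W [Vi VW WV]] := inverse_exists Vb sc0 Vm Vs.
by exists V, W.
Qed.
End SquareRoot.

(** * Finite sums over refined and shifted grids *)

Section FiniteSums.
Variable R : realType.

Lemma sum_double (f : nat -> R) m :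
  \sum_(i < m.*2) f i = \sum_(j < m) (f j.*2 + f j.*2.+1).
Proof.
elim: m => [|m IH]; first by rewrite !big_ord0.
by rewrite doubleS !big_ord_recr /= IH addrA.
Qed.

(** Discrete form of the averaging argument: the first J grid points are estimated crudely by k, and
    every later one by the value J steps earlier. *)
Lemma sum_shift_le (f h : nat -> R) (k : R) (J N : nat) : 0 <= k -> (forall i, 0 <= f i) ->
  (forall i, (i < N)%N -> (i < J)%N -> h i <= k) ->
  (forall i, (i < N)%N -> (J <= i)%N -> h i <= f (i - J)%N) ->
  \sum_(i < N) h i <= J%:R * k + \sum_(i < N) f i.
Proof.
move=> k0 f0 h1 h2.
have hk (m : nat) : (m <= J)%N -> (m <= N)%N -> \sum_(i < m) h i <= m%:R * k.
  elim: m => [|m IH] mJ mN; first by rewrite big_ord0 mul0r.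
  rewrite big_ord_recr /= -natr1 mulrDl mul1r; apply: lerD; first by apply: IH; exact: ltnW.
  exact: h1.
have [NJ|JN] := leqP N J.
  apply: (le_trans (hk N NJ (leqnn _))); apply: ler_wpDr; first by apply: sumr_ge0 => i _.
  by apply: ler_wpM2r => //; rewrite ler_nat.
have tl m : (J + m <= N)%N -> \sum_(i < J + m) h i <= J%:R * k + \sum_(i < m) f i.
  elim: m => [|m IH] mN; first by rewrite addn0 big_ord0 addr0 hk // ltnW.
  rewrite addnS !big_ord_recr /= addrA; rewrite addnS in mN.
  apply: lerD; first by apply: IH; exact: ltnW.
  by have := h2 _ mN (leq_addr _ _); rewrite addKn.
have := tl (N - J)%N; rewrite subnKC ?(ltnW JN) // => /(_ (leqnn _)) /le_trans; apply.
rewrite lerD2l; have e : N = (N - J + J)%N by rewrite subnK // ltnW.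
by rewrite [in leRHS]e big_split_ord /= lerDl sumr_ge0.
Qed.

Lemma ceil_steps (h t : R) : 0 < h -> 0 <= t -> exists J : nat, t <= J%:R * h <= t + h.
Proof.
move=> h0 t0; exists (Num.trunc (t / h)).+1.
have /truncn_itv /andP[h1 h2] : 0 <= t / h by rewrite divr_ge0 // ltW.
rewrite ler_pdivlMr // in h1; rewrite ltr_pdivrMr // in h2.
by rewrite (ltW h2) -natr1 mulrDl mul1r lerD2r.
Qed.
End FiniteSums.

(** * Renorming of a compressed semigroup *)

Section Renorming.
Variable R : realType.
Local Notation C := R[i].
Variables (H K : hilbertType R) (T : R -> H -> H) (S : R -> K -> K) (B : H -> K) (A : K -> H) (nu : R).
Hypotheses (TC0 : C0_semigroup T) (SC0 : C0_semigroup S)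
  (Sc : forall t, 0 <= t -> forall k, hnorm (S t k) <= hnorm k)
  (Bb : bounded_op B) (Ab : bounded_op A) (nu0 : 0 < nu)
  (TE : forall t, 0 <= t -> t <= nu -> forall x, T t x = A (S t (B x))).

Let Sl t : 0 <= t -> clinear (S t).
Proof. by case: SC0 => h _ _ _ /h /bop_lin. Qed.
Let Tl t : 0 <= t -> clinear (T t).
Proof. by case: TC0 => h _ _ _ /h /bop_lin. Qed.
Let Al := bop_lin Ab.
Let Bl := bop_lin Bb.

(* The absolute value makes every member of the family linear; only times [s >= 0] are used. *)
Definition delayed (s : R) (x : H) : K := S `|s| (B x).

Let delayed_lin s : clinear (delayed s).
Proof. by move=> a x y; rewrite /delayed Bl Sl. Qed.

Definition null_space (a : R) (k : K) : Prop :=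
  A k = 0 /\ exists l : seq (R * H), (forall p, p \in l -> 0 <= p.1 <= a) /\ k = lsum delayed l.

Lemma null_space0 a : null_space a 0.
Proof. by split; [exact: clin0|exists [::]; rewrite /lsum big_nil]. Qed.

Lemma null_space_lin a (c : C) k k' : null_space a k -> null_space a k' ->
  null_space a (c *: k + k').
Proof.
move=> [Ak [l [hl kE]]] [Ak' [l' [hl' kE']]]; split.
  by rewrite Al Ak Ak' scaler0 addr0.
exists (lscale c l ++ l'); split; last by rewrite lsum_cat lsum_scale // -kE -kE'.
by move=> p; rewrite mem_cat => /orP[/mapP [r /hl h ->]//|/hl'].
Qed.

Lemma null_space_mono a b k : a <= b -> null_space a k -> null_space b k.
Proof.
move=> ab [Ak [l [hl kE]]]; split => //; exists l; split => // p /hl /andP[-> pa].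
exact: le_trans ab.
Qed.

(** A kills S(t) z because A S(s + t) B = T(t) A S(s) B for s + t <= nu, and it kills B T(t) x -
    S(t) B x because A B = 1. The vector is thus an admissible correction of B T(t) x, and it leaves
    the remainder S(t) (B x - z), no longer than B x - z. *)
Lemma null_space_shift a t x z : 0 <= a -> 0 <= t -> a + t <= nu -> null_space a z ->
  null_space (a + t) (B (T t x) - S t (B x - z)).
Proof.
move=> a0 t0 at_nu [Az [l [hl zE]]].
have [_ S0 SD _] := SC0; have [_ T0 TD _] := TC0.
have tn : t <= nu by lra.
have SzE : S t z = lsum delayed [seq (p.1 + t, p.2) | p <- l].
  rewrite zE /lsum (clin_sum (Sl t0)) big_map; apply: eq_big_seq => p /hl /andP[p0 _].
  by rewrite /delayed /= !ger0_norm ?addr_ge0 // addrC SD.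
have ASz : A (S t z) = 0.
  rewrite SzE /lsum (clin_sum Al) big_map.
  have -> : \sum_(p <- l) A (delayed (p.1 + t) p.2) = T t (A z).
    rewrite zE /lsum (clin_sum Al) (clin_sum (Tl t0)); apply: eq_big_seq => p /hl /andP[p0 pa].
    by rewrite /delayed !ger0_norm ?addr_ge0 // -!TE ?addr_ge0 //; [rewrite addrC TD|lra|lra].
  by rewrite Az (clin0 (Tl t0)).
split.
  rewrite (clinB (Sl t0)) (clinB Al) (clinB Al) ASz subr0 -TE // -{1}[B _]S0 -TE ?(ltW nu0) //.
  by rewrite T0 subrr.
exists ([:: (0, T t x)] ++ lscale (-1) [:: (t, x)] ++ [seq (p.1 + t, p.2) | p <- l]); split.
  move=> p; rewrite !mem_cat => /orP[|/orP[]].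
  - by rewrite inE => /eqP -> /=; rewrite lexx addr_ge0.
  - by rewrite /lscale /= inE => /eqP -> /=; rewrite t0 lerDr.
  - by move=> /mapP [r /hl /andP[r0 ra] ->] /=; rewrite addr_ge0 // lerD2r.
rewrite !lsum_cat lsum_scale // -SzE !lsum1 /delayed normr0 S0 (ger0_norm t0) scaleN1r.
by rewrite (clinB (Sl t0)) opprB [- _ + _]addrC.
Qed.

(** [Q a x] is the component of [B x] orthogonal to [null_space a]. The distance to that subspace is
    thereby the norm of a linear map into a Hilbert space, hence Hilbertian. *)
Lemma quotient_norms : exists Q : R -> H -> K, [/\ (forall a, clinear (Q a)),
   (forall a b x, a <= b -> hnorm (Q b x) <= hnorm (Q a x)),
   (forall a t x, 0 <= a -> 0 <= t -> a + t <= nu -> hnorm (Q (a + t) (T t x)) <= hnorm (Q a x)),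
   (exists2 M, 0 < M & forall a x, hnorm (Q a x) <= M * hnorm x) &
   (exists2 M, 0 < M & forall a x, hnorm x <= M * hnorm (Q a x))].
Proof.
have Zs a : real_subspace (null_space a).
  by split; [exact: null_space0|move=> r x y; exact: null_space_lin].
have /choice [Q hQ] : forall ax : R * H, exists w, orth_part (null_space ax.1) (B ax.2) w.
  by move=> ax; exact: orth_part_exists.
exists (fun a x => Q (a, x)); split.
- move=> a c x y; apply: (orth_part_lin (null_space0 a) (@null_space_lin a) (hQ (a, x)) (hQ (a, y))).
  by have := hQ (a, c *: x + y); rewrite /= Bl.
- move=> a b x ab; apply/ler_addgt0Pr => e e0.
  have [z Zz hz] := orth_part_approx (hQ (a, x)) e0.
  by apply: ltW; apply: le_lt_trans hz; apply: (orth_part_min (hQ (b, x))); exact: null_space_mono Zz.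
- move=> a t x a0 t0 at_nu; apply/ler_addgt0Pr => e e0.
  have [z Zz hz] := orth_part_approx (hQ (a, x)) e0.
  have := orth_part_min (hQ (a + t, T t x)) (null_space_shift x a0 t0 at_nu Zz).
  rewrite /= subKr => h; apply: le_trans h _; apply: le_trans (Sc t0 _) _; exact: ltW.
- have [M M0 hM] := bop_bound Bb; exists M => // a x; apply: le_trans (hM x).
  by have := orth_part_min (hQ (a, x)) (null_space0 a); rewrite subr0.
- have [M M0 hM] := bop_bound Ab; exists M => // a x; rewrite -ler_pdivrMl //.
  apply/ler_addgt0Pr => e e0; have [z [Az _] hz] := orth_part_approx (hQ (a, x)) e0.
  have [_ S0 _ _] := SC0; have [_ T0 _ _] := TC0.
  apply: le_trans (ltW hz); rewrite ler_pdivrMl //; apply: le_trans (hM _).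
  by rewrite (clinB Al) Az subr0 /= -(S0 (B x)) -TE ?(ltW nu0) // T0.
Qed.

Lemma renorming : exists (V W : H -> H) (mu : R), [/\ invertible_op V,
  (forall x, V (W x) = x), (forall x, W (V x) = x) &
  forall t, 0 <= t -> forall x, hnorm (V (T t (W x))) <= expR (mu * t) * hnorm x].
Proof.
have [Q [Ql Qmono Qshift [M2 M20 Qub] [M1 M10 Qlb]]] := quotient_norms.
pose s (n : nat) (x y : H) : R :=
  (2 ^+ n)^-1 * \sum_(i < 2 ^ n) rip (Q (nu * (i%:R / 2 ^+ n)) x) (Q (nu * (i%:R / 2 ^+ n)) y).
have p20 n : 0 < 2 ^+ n :> R by rewrite exprn_gt0.
have sD n x y z : s n (x + y) z = s n x z + s n y z.
  by rewrite /s -mulrDr -big_split /=; congr (_ * _); apply: eq_bigr => i _; rewrite (clinD (Ql _)) ripDl.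
have sC n x y : s n x y = s n y x.
  by rewrite /s; congr (_ * _); apply: eq_bigr => i _; rewrite ripC.
have sZ n a x y : s n (a *: x) y = s n x (conjc a *: y).
  by rewrite /s; congr (_ * _); apply: eq_bigr => i _; rewrite !(clinZ (Ql _)) ripZ.
have sR n (r : R) x y : s n ((r%:C)%C *: x) y = r * s n x y.
  rewrite /s mulrCA; congr (_ * _); rewrite mulr_sumr; apply: eq_bigr => i _.
  by rewrite (clinZ (Ql _)) ripRl.
have sE n x : s n x x = (2 ^+ n)^-1 * \sum_(i < 2 ^ n) hnorm (Q (nu * (i%:R / 2 ^+ n)) x) ^+ 2.
  by rewrite /s; congr (_ * _); apply: eq_bigr => i _; rewrite hn_sqr.
have avg n (r : R) : (2 ^+ n)^-1 * \sum_(i < 2 ^ n) r = r.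
  by rewrite sumr_const card_ord -[r *+ _]mulr_natl natrX mulrA mulVf ?mul1r // lt0r_neq0.
have sub n x : s n x x <= M2 ^+ 2 * hnorm x ^+ 2.
  rewrite sE -[leRHS](avg n); apply: ler_wpM2l; first by rewrite invr_ge0 ltW.
  apply: ler_sum => i _; rewrite -exprMn ler_pXn2r ?nnegrE ?mulr_ge0 ?hn_ge0 ?(ltW M20) //.
have slb n x : (M1 ^+ 2)^-1 * hnorm x ^+ 2 <= s n x x.
  rewrite sE -[leLHS](avg n); apply: ler_wpM2l; first by rewrite invr_ge0 ltW.
  apply: ler_sum => i _; rewrite ler_pdivrMl ?exprn_gt0 // -exprMn.
  by rewrite ler_pXn2r ?nnegrE ?mulr_ge0 ?hn_ge0 ?(ltW M10).
(* Refining the grid keeps each old point as an even index and adds the next odd one, where the norm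
   is no larger. *)
have smono n x : s n.+1 x x <= s n x x.
  pose f m (i : nat) := hnorm (Q (nu * (i%:R / 2 ^+ m)) x) ^+ 2.
  have le2 : \sum_(i < 2 ^ n.+1) f n.+1 i <= 2 * \sum_(i < 2 ^ n) f n i.
    rewrite expnS mul2n (sum_double (f n.+1)) mulr_sumr; apply: ler_sum => j _.
    have e : nu * (j.*2%:R / 2 ^+ n.+1) = nu * (j%:R / 2 ^+ n).
      by rewrite exprS -mul2n natrM -mulf_div divff // mul1r.
    rewrite mulrDl mul1r; apply: lerD; first by rewrite /f e.
    rewrite /f ler_pXn2r ?nnegrE ?hn_ge0 //; apply: Qmono.
    by rewrite -e ler_pM2l // ler_pM2r ?ler_nat // invr_gt0.
  rewrite !sE; apply: (le_trans (ler_wpM2l _ le2)); first by rewrite invr_ge0 ltW.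
  by rewrite exprS invfM mulrACA mulVf // mul1r.
have /choice [g0 hg0] : forall x : H * H, exists l : R, (fun n => s n x.1 x.2) @ \oo --> l.
  (* Only the diagonal sequence is monotone; convergence for a pair follows by polarisation. *)
  have diag x : exists l : R, (fun n => s n x x) @ \oo --> l.
    apply/cvg_ex; apply: nonincreasing_is_cvgn.
      by apply/nonincreasing_seqP => n; exact: smono.
    by exists 0 => _ [n _ <-]; apply: le_trans (slb n x); rewrite mulr_ge0 ?invr_ge0 ?sqr_ge0.
  move=> [x y] /=; have [l1 h1] := diag (x + y); have [l2 h2] := diag (x - y).
  exists ((l1 - l2) / 4).
  apply: (@seq_cvg_ext _ (fun n => (s n (x + y) (x + y) - s n (x - y) (x - y)) / 4)); last first.
    by apply: cvgM; [exact: cvgB|exact: cvg_cst].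
  move=> n; rewrite !sD !(sC n _ (x + y)) !(sC n _ (x - y)) !sD.
  have sN z w : s n (- z) w = - s n z w.
    by rewrite -(scaleN1r z) (_ : -1 = ((-1)%:C)%C) ?sR ?mulN1r // rmorphN1.
  by rewrite !sN (sC n x (- y)) sN (sC n y (- y)) sN (sC n y x); field.
pose g x y := g0 (x, y).
have hg x y : (fun n => s n x y) @ \oo --> g x y := hg0 (x, y).
have gD x y z : g (x + y) z = g x z + g y z.
  apply: (seq_cvg_uniq (hg _ _)); apply: (@seq_cvg_ext _ (fun n => s n x z + s n y z)); last exact: cvgD.
  by move=> n; rewrite sD.
have gC x y : g x y = g y x.
  by apply: (seq_cvg_uniq (hg _ _)); apply: seq_cvg_ext (hg y x) => n; rewrite sC.
have gZ a x y : g (a *: x) y = g x (conjc a *: y).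
  by apply: (seq_cvg_uniq (hg _ _)); apply: seq_cvg_ext (hg x (conjc a *: y)) => n; rewrite sZ.
have gR (r : R) x y : g ((r%:C)%C *: x) y = r * g x y.
  apply: (seq_cvg_uniq (hg _ _)); apply: (@seq_cvg_ext _ (fun n => r * s n x y)); last by apply: cvgM; [exact: cvg_cst|].
  by move=> n; rewrite sR.
have glb x : (M1 ^+ 2)^-1 * hnorm x ^+ 2 <= g x x by apply: (seq_cvg_le (cvg_cst _) (hg x x)).
have gub x : g x x <= M2 ^+ 2 * hnorm x ^+ 2 by apply: (seq_cvg_lec (hg x x)).
have c0 : 0 < (M1 ^+ 2)^-1 by rewrite invr_gt0 exprn_gt0.
(* The maximum secures c <= c' even on the zero space, where the two bounds do not compare the
   constants. *)
pose c' := Num.max (M2 ^+ 2) (M1 ^+ 2)^-1.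
have gub' x : g x x <= c' * hnorm x ^+ 2.
  by apply: le_trans (gub x) _; apply: ler_wpM2r; rewrite ?sqr_ge0 // le_max lexx.
have cc : (M1 ^+ 2)^-1 <= c' by rewrite le_max lexx orbT.
have [V [W [Vi VW WV Vn]]] := form_sqrt gD gC gZ c0 cc glb gub' gR.
have [MA MA0 hMA] := bop_bound Ab; have [MB MB0 hMB] := bop_bound Bb.
have Tb t x : 0 <= t -> t <= nu -> hnorm (T t x) <= MA * MB * hnorm x.
  move=> t0 tn; rewrite TE // -mulrA; apply: le_trans (hMA _) _; rewrite ler_pM2l //.
  by apply: le_trans (Sc t0 _) _.
pose k := (M2 * (MA * MB)) ^+ 2.
have grow t x : 0 <= t -> t <= nu -> g (T t x) (T t x) <= g x x + t / nu * (k * hnorm x ^+ 2).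
  move=> t0 tn.
  (* t is rounded up to J grid steps, so that an index moved back by J steps lies at least t
     earlier. The J crude terms weigh J / 2^n <= t / nu + 2^-n, and the rounding error disappears in
     the limit. *)
  have sgrow n : s n (T t x) (T t x) <= s n x x + (t / nu + (2^-1) ^+ n) * (k * hnorm x ^+ 2).
    have h0 : 0 < nu / 2 ^+ n by rewrite divr_gt0.
    have [J /andP[J1 J2]] := ceil_steps h0 t0.
    have kx : 0 <= k * hnorm x ^+ 2 by rewrite mulr_ge0 ?sqr_ge0.
    have grid0 (i : nat) : 0 <= nu * (i%:R / 2 ^+ n) by rewrite mulr_ge0 ?divr_ge0 // ltW.
    pose f (i : nat) := hnorm (Q (nu * (i%:R / 2 ^+ n)) x) ^+ 2.
    pose h (i : nat) := hnorm (Q (nu * (i%:R / 2 ^+ n)) (T t x)) ^+ 2.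
    have sh : \sum_(i < 2 ^ n) h i <= J%:R * (k * hnorm x ^+ 2) + \sum_(i < 2 ^ n) f i.
      apply: sum_shift_le => //; first by move=> i; exact: sqr_ge0.
      - move=> i _ _; rewrite /h /k -exprMn ler_pXn2r ?nnegrE ?mulr_ge0 ?hn_ge0 ?(ltW M20) ?(ltW MA0) ?(ltW MB0) //.
        apply: le_trans (Qub _ _) _; rewrite -mulrA ler_pM2l //; exact: Tb.
      - move=> i iN Ji; rewrite /h /f ler_pXn2r ?nnegrE ?hn_ge0 //.
        have i1 : nu * (i%:R / 2 ^+ n) <= nu.
          rewrite ler_piMr ?(ltW nu0) // ler_pdivrMr // mul1r -natrX ler_nat; exact: ltnW.
        have iJ : nu * ((i - J)%:R / 2 ^+ n) <= nu * (i%:R / 2 ^+ n) - t.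
          rewrite natrB // mulrBl mulrBr lerD2l lerN2; apply: le_trans J1 _.
          by rewrite mulrCA.
        have -> : nu * (i%:R / 2 ^+ n) = (nu * (i%:R / 2 ^+ n) - t) + t by rewrite subrK.
        apply: le_trans (Qshift _ _ _ _ t0 _) _.
        + by apply: le_trans iJ.
        + by rewrite subrK.
        + exact: Qmono.
    rewrite !sE.
    have h' : J%:R / 2 ^+ n <= t / nu + 2^-1 ^+ n.
      rewrite exprVn -(ler_pM2l nu0) mulrCA mulrDr; apply: le_trans J2 _.
      by rewrite mulrCA divff ?mulr1 // lt0r_neq0.
    apply: le_trans (ler_wpM2l _ sh) _; first by rewrite invr_ge0 ltW.
    rewrite mulrDr [leLHS]addrC; apply: lerD; first by [].
    by rewrite mulrCA mulrA; apply: ler_wpM2r.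
  have h2 : (fun n => s n x x + (t / nu + (2^-1) ^+ n) * (k * hnorm x ^+ 2)) @ \oo -->
      g x x + (t / nu + 0) * (k * hnorm x ^+ 2).
    apply: cvgD; first exact: hg.
    apply: cvgM; last exact: cvg_cst.
    apply: cvgD; first exact: cvg_cst.
    by apply: cvg_expr; rewrite ger0_norm ?invr_ge0 // invf_lt1 // ltr1n.
  by rewrite addr0 in h2; apply: (seq_cvg_le (hg _ _) h2).
pose mu := k * M1 ^+ 2 / nu.
have egrow t x : 0 <= t -> t <= nu -> g (T t x) (T t x) <= expR (mu * t) * g x x.
  move=> t0 tn; apply: le_trans (grow t x t0 tn) _.
  have gx0 : 0 <= g x x by apply: le_trans (glb x); rewrite mulr_ge0 ?sqr_ge0 // ltW.
  apply: (@le_trans _ _ ((1 + mu * t) * g x x)); last by apply: ler_wpM2r => //; exact: expR_ge1Dx.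
  rewrite mulrDl mul1r lerD2l.
  have -> : mu * t * g x x = t / nu * (k * (M1 ^+ 2 * g x x)) by rewrite /mu; ring.
  apply: ler_wpM2l; first by rewrite divr_ge0 // ltW.
  apply: ler_wpM2l; first exact: sqr_ge0.
  by rewrite -ler_pdivrMl ?exprn_gt0.
have [_ T0 TD _] := TC0.
(* Arbitrary times are multiples of short ones; the exponential bounds multiply without accumulating
   a constant. *)
have pgrow t x (m : nat) : 0 <= t -> t <= nu ->
    g (T (m%:R * t) x) (T (m%:R * t) x) <= expR (mu * (m%:R * t)) * g x x.
  move=> t0 tn; elim: m => [|m IH]; first by rewrite mul0r mulr0 expR0 T0 mul1r.
  have mt0 : 0 <= m%:R * t by rewrite mulr_ge0.
  rewrite -natr1 mulrDl mul1r addrC TD //; apply: le_trans (egrow _ _ t0 tn) _.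
  by rewrite mulrDr expRD -mulrA ler_wpM2l ?expR_ge0.
(* [g] is the squared new norm, hence half the exponent. *)
exists V, W, (mu / 2); split => // t t0 x.
have [m /andP[m1 _]] := ceil_steps nu0 t0.
have mm : t <= m.+1%:R * nu by apply: le_trans m1 _; rewrite ler_pM2r // ler_nat.
have := pgrow (t / m.+1%:R) (W x) m.+1.
rewrite divr_ge0 // ler_pdivrMr // [nu * _]mulrC mm mulrCA divff // mulr1 => /(_ erefl erefl).
rewrite -!Vn VW => h.
rewrite -(@ler_pXn2r _ 2) ?nnegrE ?mulr_ge0 ?hn_ge0 ?expR_ge0 // exprMn.
rewrite [expR _ ^+ 2]expr2 -expRD; suff -> : mu / 2 * t + mu / 2 * t = mu * t by [].
by field.
Qed.
End Renorming.

(** * Compressions of quasi-contractions, and the cycle of implications *)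

Lemma compression_quasi_contraction (R : realType) (H K : hilbertType R) (T : R -> H -> H)
    (S : R -> K -> K) (B : H -> K) (A : K -> H) (nu : R) :
  C0_semigroup T -> C0_semigroup S -> similar_to_quasi_contraction S -> 0 < nu ->
  bounded_op B -> bounded_op A ->
  (forall t, 0 <= t -> t <= nu -> forall x, T t x = A (S t (B x))) ->
  similar_to_quasi_contraction T.
Proof.
move=> TC0 SC0 [V [W [Vi VW WV [lam hlam]]]] nu0 Bb Ab TE.
have Vb := Vi.1; have Wb := inverse_bounded Vi WV.
have l0 := normr_ge0 lam.
have idb := bop_id H.
(* [T] and [S] are damped by the same exponential, so the compression identity survives once the
   similarity of [S] is absorbed into [A] and [B]. The exponent is restored in the final bound. *)
have T'C0 := rescaled_C0 TC0 idb idb (fun=> erefl) (fun=> erefl) l0.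
have S'C0 := rescaled_C0 SC0 Vb Wb VW WV l0.
have S'c := @rescaled_contraction _ _ S V W _ _ (ler_norm lam) hlam.
have TE' t : 0 <= t -> t <= nu -> forall x,
    rescaled (fun x => x) (fun x => x) `|lam| T t x = A (W (rescaled V W `|lam| S t (V (B x)))).
  move=> t0 tn x; rewrite /rescaled (clinZ (bop_lin Wb)) (clinZ (bop_lin Ab)) !WV.
  by rewrite TE.
have [P [Q [mu [Pi PQ QP hP]]]] := renorming T'C0 S'C0 S'c (bop_comp Bb Vb) (bop_comp Wb Ab) nu0 TE'.
exists P, Q; split => //; exists (mu + `|lam|) => t t0 x.
have := hP t t0 x; rewrite /rescaled (clinZ (bop_lin Pi.1)) hnR ger0_norm ?expR_ge0 // => h.
have e0 : 0 < expR (- (`|lam| * t)) := expR_gt0 _.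
rewrite -(ler_pM2l e0); apply: le_trans h _.
rewrite mulrA -expRD; have -> : - (`|lam| * t) + (mu + `|lam|) * t = mu * t by ring.
by [].
Qed.

Theorem theorem1p2 (R : realType) (H : hilbertType R) (T : R -> H -> H) :
  C0_semigroup T ->
  [<->
    (* (i) *)
    similar_to_quasi_contraction T;
    (* (ii) *)
    (forall nu : R, 0 < nu ->
       exists (K : hilbertType R) (B : H -> K) (A : K -> H) (N : R -> K -> K),
         [/\ bounded_op B, bounded_op A, contractive_nilpotent_C0_semigroup N &
             forall t, 0 <= t -> t <= nu -> forall x, T t x = A (N t (B x))]);
    (* (iii) *)
    (forall nu : R, 0 < nu ->
       exists (K : hilbertType R) (B : H -> K) (A : K -> H) (U : R -> K -> K),
         [/\ bounded_op B, bounded_op A, unitary_C0_group U &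
             forall t, 0 <= t -> t <= nu -> forall x, T t x = A (U t (B x))]);
    (* (iv) *)
    (exists (nu : R) (K : hilbertType R) (B : H -> K) (A : K -> H)
            (S : R -> K -> K),
       [/\ 0 < nu, bounded_op B, bounded_op A,
           C0_semigroup S /\ similar_to_quasi_contraction S &
           forall t, 0 <= t -> t <= nu -> forall x, T t x = A (S t (B x))])].
Proof.
move=> TC0; tfae.
- exact: quasi_contraction_nilpotent.
- move=> h nu /h [K [B [A [N [Bb Ab [NC0 Nc _] hN]]]]].
  have [L [J [P [U [Jb Pb UC0 hU]]]]] := unitary_dilation NC0 Nc.
  exists L, (fun x => J (B x)), (fun l => A (P l)), U; split => //.
  + exact: bop_comp Bb Jb.
  + exact: bop_comp Pb Ab.
  + by move=> t t0 tn x; rewrite hN // hU.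
(* Restricted to t >= 0 the group is a semigroup of isometries: the similarity is the identity, the
   exponent is 0, and any horizon serves. *)
- move=> /(_ 1 ltr01) [K [B [A [U [Bb Ab [Uu U0 UD Uc] hU]]]]].
  have Uiso t k : hnorm (U t k) = hnorm k.
    by have [_ /(_ k k) e _] := Uu t; rewrite /hnorm /ip_norm e.
  have Ub t : bounded_op (U t).
    by have [Ul _ _] := Uu t; split => //; exists 1 => k; rewrite Uiso mul1r.
  exists 1, K, B, A, U; split => //; split.
    split => // k eps e0; have [d d0 hd] := Uc k eps e0; exists d => // t t0 td.
    by apply: hd; rewrite ger0_norm.
  have idb := bop_id K; exists id, id; split => //; first by split => //; exists id.
  by exists 0 => t t0 k; rewrite mul0r expR0 mul1r Uiso.
- move=> [nu [K [B [A [S [nu0 Bb Ab [SC0 Sq] hS]]]]]].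
  exact: (compression_quasi_contraction TC0 SC0 Sq nu0 Bb Ab hS).
Qed.
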